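(* Let $n\ge2$ and let $\mu$ be a locally finite Borel measure on $\mathbb{R}^n$ that is absolutely continuous with respect to Lebesgue measure and such that $(\mathrm{M}_1\mu)(x_0)<\infty$ for some $x_0\in\mathbb{R}^n$. Then there is a constant $C>0$, independent of $u$, such that for every $u\in \mathrm{BV}(\mathrm{M}_1\mu)$, $$\|u\|_{L^1(\mu)}\le C\,|Du|_{\mathrm{M}_1\mu}(\mathbb{R}^n).$$
   Context: A locally finite Borel measure on $\mathbb{R}^n$ is a positive Borel measure $\mu$ with $\mu(K)<\infty$ for every compact $K$. $\mathcal{L}$ denotes Lebesgue measure, and $\mathrm{M}_1\mu(x)=\sup_{r>0} r\,\mu(B_r(x))/\mathcal{L}(B_r(x))$. When $\mathrm{M}_1\mu$ is finite at some point, it is a lower semicontinuous, locally integrable function. Weighted BV: for a positive lower semicontinuous weight $w$ on $\mathbb{R}^n$, a function $u\in L^1(w)$ (i.e. $\int|u|w\,dx<\infty$) belongs to $\mathrm{BV}(w)$ if $$|Du|_w(\mathbb{R}^n):=\sup\Big\{\int_{\mathbb{R}^n}u\,\mathrm{div}\,\boldsymbol\Phi\,dx:\ \boldsymbol\Phi\in C^1_c(\mathbb{R}^n,\mathbb{R}^n),\ |\boldsymbol\Phi(x)|\le w(x)\ \text{for all }x\in\mathbb{R}^n\Big\}<\infty.$$ *)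

(* Defs.v *)
From HB Require Import structures.
From mathcomp Require Import all_boot all_order all_algebra.
From mathcomp Require Import all_classical all_reals all_analysis.
From mathcomp Require Import measurable_realfun.

Set Implicit Arguments.
Unset Strict Implicit.
Unset Printing Implicit Defensive.

Import Order.TTheory GRing.Theory Num.Theory.
Import numFieldNormedType.Exports.

Local Open Scope classical_set_scope.
Local Open Scope ring_scope.

Definition borel_rV_display : measure_display.
Proof. exact: default_measure_display. Qed.

(* 'rV[R]_n carries the Borel sigma-algebra of its (Euclidean) topology. *)
HB.instance Definition _ (R : realType) (n : nat) :=
  @isMeasurable.Build borel_rV_display 'rV[R]_n <<s @open 'rV[R]_n >>
    (@sigma_algebra0 _ setT open) (@sigma_algebraC _ open)
    (@sigma_algebra_bigcup _ setT open).

Section rV_measurability.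
Context {R : realType}.

Lemma open_measurable_rV n (U : set 'rV[R]_n) : open U -> measurable U.
Proof. exact: sub_sigma_algebra. Qed.

Lemma measurable_coord n (i : 'I_n) :
  measurable_fun [set: 'rV[R]_n] (fun x : 'rV[R]_n => x ord0 i).
Proof.
apply: (measurability _ (RGenOpens.measurableE R)) => _ [_ [a [b ->]] <-].
rewrite setTI; apply: open_measurable_rV.
apply: open_comp; last exact: interval_open.
by move=> x _; exact: coord_continuous.
Qed.

Lemma open_rV_bigcup_rat n (U : set 'rV[R]_n) : open U ->
  U = \bigcup_(q in [set q : 'rV[rat]_n * rat |
                ball (map_mx ratr q.1 : 'rV[R]_n) (ratr q.2) `<=` U])
        ball (map_mx ratr q.1 : 'rV[R]_n) (ratr q.2 : R).
Proof.
move=> oU; apply/seteqP; split; last by move=> x [q] /= qU; exact: qU.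
move=> x Ux.
have /nbhs_ballP[e /= e0 eU] : nbhs x U by exact: open_nbhs_nbhs.
have /rat_in_itvoo[r] : (0 < e / 2 :> R) by rewrite divr_gt0.
rewrite in_itv /= => /andP[r0 re].
have /choice[f Hf] (i : 'I_n) : exists q : rat, `|ratr q - x ord0 i| < ratr r.
  have /rat_in_itvoo[q] : (x ord0 i - ratr r < x ord0 i + ratr r).
    by rewrite ltrBlDr -addrA ltrDl addr_gt0.
  rewrite in_itv /= => /andP[q1 q2]; exists q.
  by rewrite ltr_distl q1.
have xb : ball (map_mx ratr (\row_i f i) : 'rV[R]_n) (ratr r : R) x.
  split => // i j; rewrite !mxE (ord1 i).
  exact: Hf.
exists (\row_i f i, r) => //= y qy; apply: eU.
by apply: ball_splitr; [apply: le_ball (ltW re) _ xb|apply: le_ball (ltW re) _ qy].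
Qed.

Lemma measurable_fun_rV d (T : measurableType d) n (f : T -> 'rV[R]_n) :
  (forall i, measurable_fun setT (fun x => f x ord0 i)) -> measurable_fun setT f.
Proof.
move=> mf; apply: (@measurability _ _ _ _ _ _ (@open (matrix R 1 n))) => // _ [U oU <-].
rewrite setTI (open_rV_bigcup_rat oU) preimage_bigcup.
rewrite bigcup_mkcond; apply: countable_bigcupT_measurable => // q.
case: ifPn => // _.
have [r0|r0] := ltP 0 (ratr q.2 : R); last first.
  rewrite (_ : _ @^-1` _ = set0)//; apply/seteqP; split => // x /= [].
  by rewrite ltNge r0.
rewrite (_ : _ @^-1` _ = \bigcap_(i in [set: 'I_n])
    ((fun x => f x ord0 i) @^-1` (ball (ratr (q.1 ord0 i) : R) (ratr q.2 : R)))).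
  apply: fin_bigcap_measurable => // i _.
  rewrite -[X in measurable X]setTI; apply: mf => //.
  by apply: open_measurable; exact: ball_open.
apply/seteqP; split => x /=.
  by move=> [_ qf] i _ /=; have := qf ord0 i; rewrite mxE.
by move=> qf; split=> // i j; rewrite mxE (ord1 i); exact: qf.
Qed.

End rV_measurability.

Section lebesgue_rV.
Context {R : realType}.

Definition consrV n (tx : measurableTypeR R * 'rV[R]_n) : 'rV[R]_n.+1 :=
  \row_i oapp (tx.2 ord0) tx.1 (unlift ord0 i).

Lemma measurable_consrV n : measurable_fun setT (@consrV n).
Proof.
apply: measurable_fun_rV => i.
have [j ->|->] := unliftP ord0 i; under eq_fun do rewrite mxE ?liftK ?unlift_none.
  exact: (measurableT_comp (measurable_coord j) measurable_snd).
exact: measurable_fst.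
Qed.

Section lebesgue_rVS.
Variables (n : nat) (m : {sigma_finite_measure set 'rV[R]_n -> \bar R}).

Definition lebesgue_rVS : set 'rV[R]_n.+1 -> \bar R :=
  pushforward (lebesgue_measure \x m)%E (@consrV n).

Let measurable_consrV_preimage A :
  measurable A -> measurable (@consrV n @^-1` A).
Proof.
by move=> mA; rewrite -[X in measurable X]setTI; exact: measurable_consrV.
Qed.

Let lebesgue_rVS0 : lebesgue_rVS set0 = 0%E.
Proof. by rewrite /lebesgue_rVS /pushforward preimage_set0 measure0. Qed.

Let lebesgue_rVS_ge0 A : (0 <= lebesgue_rVS A)%E.
Proof. exact: (measure_ge0 (lebesgue_measure \x m)%E). Qed.

Let lebesgue_rVS_sigma_additive : semi_sigma_additive lebesgue_rVS.
Proof.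
move=> F mF tF mUF; rewrite /lebesgue_rVS /pushforward preimage_bigcup.
apply: measure_semi_sigma_additive => //.
- by move=> i; exact: measurable_consrV_preimage.
- apply/trivIsetP => /= i j _ _ ij; rewrite -preimage_setI.
  by move/trivIsetP : tF => /(_ _ _ _ _ ij) ->//; rewrite preimage_set0.
- by rewrite -preimage_bigcup; exact: measurable_consrV_preimage.
Qed.

HB.instance Definition _ := isMeasure.Build _ _ _ lebesgue_rVS
  lebesgue_rVS0 lebesgue_rVS_ge0 lebesgue_rVS_sigma_additive.

Lemma lebesgue_rVS_prod (A : set R) (B : set 'rV[R]_n) :
  measurable A -> measurable B ->
  lebesgue_rVS [set x | A (x ord0 ord0) /\
                        B (\row_j x ord0 (lift ord0 j))] =
  (lebesgue_measure A * m B)%E.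
Proof.
move=> mA mB; rewrite /lebesgue_rVS /pushforward.
rewrite (_ : _ @^-1` _ = A `*` B); first exact: product_measure1E.
apply/seteqP; split=> -[t x] /=; rewrite mxE unlift_none /=.
  move=> [At Bx]; split=> //; congr (B _) : Bx.
  by apply/rowP => j; rewrite !mxE liftK.
move=> [At Bx]; split=> //; congr (B _) : Bx.
by apply/rowP => j; rewrite !mxE liftK.
Qed.

Let lebesgue_rVS_sigma_finite : sigma_finite setT lebesgue_rVS.
Proof.
have /sigma_finiteP[F [FT ndF Ffin]] := sigma_finiteT (@lebesgue_measure R).
have /sigma_finiteP[G [GT ndG Gfin]] := sigma_finiteT m.
exists (fun k => [set x : 'rV[R]_n.+1 | F k (x ord0 ord0) /\
                          G k (\row_j x ord0 (lift ord0 j))]); last first.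
  move=> k; have [mF Foo] := Ffin k; have [mG Goo] := Gfin k; split.
    apply: measurableI.
      rewrite -[X in measurable X]setTI.
      exact: (measurable_coord ord0).
    rewrite -[X in measurable X]setTI; apply: measurable_fun_rV => // i.
    by under eq_fun do rewrite mxE; exact: measurable_coord.
  by rewrite lebesgue_rVS_prod// lte_mul_pinfty// ge0_fin_numE.
apply/seteqP; split=> // x _.
have [i _ Fi] : (\bigcup_i F i) (x ord0 ord0) by rewrite -FT.
have [j _ Gj] : (\bigcup_i G i) (\row_j x ord0 (lift ord0 j)) by rewrite -GT.
exists (maxn i j) => //; split.
- by move: Fi; exact/subsetPset/ndF/leq_maxl.
- by move: Gj; exact/subsetPset/ndG/leq_maxr.
Qed.

HB.instance Definition _ := Measure_isSigmaFinite.Build _ _ _ lebesgue_rVS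
  lebesgue_rVS_sigma_finite.

End lebesgue_rVS.

(* Lebesgue measure on R^n as the n-fold product of the one-dimensional one,
   transported along R * R^n ~ R^(n+1); lebesgue_rV_box characterizes it. *)
Fixpoint lebesgue_rV n : {sigma_finite_measure set 'rV[R]_n -> \bar R} :=
  match n with
  | 0 => @dirac _ 'rV[R]_0 0 R
  | n'.+1 => lebesgue_rVS (lebesgue_rV n')
  end.

Lemma lebesgue_rV_box n (A : 'I_n -> set R) :
  (forall i, measurable (A i)) ->
  lebesgue_rV n [set x | forall i, A i (x ord0 i)] =
  (\prod_(i < n) lebesgue_measure (A i))%E.
Proof.
elim: n A => [|n ih] A mA /=.
  by rewrite big_ord0 diracE mem_set// => -[].
rewrite big_ord_recl -(ih (fun j => A (lift ord0 j)))// -lebesgue_rVS_prod//.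
  congr (lebesgue_rVS _ _); apply/seteqP; split => x /= Ax.
    by split=> // j; rewrite mxE.
  by move=> i; have [j ->|->] := unliftP ord0 i; [have := Ax.2 j; rewrite mxE|case: Ax].
rewrite (_ : (fun x => _) = \bigcap_(j in [set: 'I_n])
    ((fun x : 'rV[R]_n => x ord0 j) @^-1` A (lift ord0 j))).
  apply: fin_bigcap_measurable => // j _.
  rewrite -[X in measurable X]setTI.
  exact: (measurable_coord j).
by apply/seteqP; split => x /= Ax j => [_|]; exact: Ax.
Qed.

End lebesgue_rV.

Section weighted_BV.
Context {R : realType} {n : nat}.
Implicit Types (mu : set 'rV[R]_n -> \bar R) (w : 'rV[R]_n -> \bar R).
Implicit Types (u : 'rV[R]_n -> R) (Phi : 'rV[R]_n -> 'rV[R]_n).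

Definition locally_finite mu := forall K, compact K -> (mu K < +oo)%E.

(* The norm and the balls of the library on 'rV[R]_n are those of the maximum
   norm; the mathematics uses the Euclidean ones. *)
Definition enorm (x : 'rV[R]_n) : R := Num.sqrt (\sum_(i < n) x ord0 i ^+ 2).

Definition eball (x : 'rV[R]_n) (r : R) : set 'rV[R]_n :=
  [set y | enorm (y - x) < r].

Definition M1 mu (x : 'rV[R]_n) : \bar R :=
  ereal_sup [set (r%:E * mu (eball x r) / lebesgue_rV n (eball x r))%E
            | r in [set r : R | 0 < r]].

Definition continuously_differentiable Phi :=
  (forall x, differentiable Phi x) /\ continuous (fun x => 'J Phi x).

Definition compactly_supported Phi := compact (closure [set x | Phi x != 0]).

Definition divergence Phi (x : 'rV[R]_n) : R :=
  \sum_(i < n) 'D_(delta_mx ord0 i) (fun y => Phi y ord0 i) x.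

(* Weights are extended-valued, since M1 mu may be infinite at some points;
   elements of L^1(w) are given by Borel representatives. *)
Definition L1_weight w u :=
  measurable_fun setT u /\
  (\int[lebesgue_rV n]_x (`|u x|%:E * w x) < +oo)%E.

(* If w is positive and lower semicontinuous then u is locally integrable, so
   every integral below is finite. *)
Definition variation_weight w u : \bar R :=
  ereal_sup [set (\int[lebesgue_rV n]_x (u x * divergence Phi x)%:E)%E
            | Phi in [set Phi | [/\ continuously_differentiable Phi,
                                    compactly_supported Phi &
                                    forall x, ((enorm (Phi x))%:E <= w x)%E]]].

Definition BV_weight w u :=
  L1_weight w u /\ (variation_weight w u < +oo)%E.

End weighted_BV.

(* Main.v *)
(* Split a large box into cubes of side h and let U z be the average of u on the
   cube z against a C^1 bump supported in it.  For neighbouring cubes z, z', the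
   difference of the two bumps is the divergence of an explicit C^1 field
   supported in the two cubes, so that testing the variation against signed,
   weighted sums of these fields gives
     sum_(z,z') W(z,z') |U z - U z'| <= C |Du|_(M1 mu),
   as soon as W <= c h^(n-1) M1 mu near the edge (z,z').  The choice
   W(z,z') = max over dyadic cubes Q of side 2^j h containing both z and z' of
   2^(-j(n-1)) mu(Q) is admissible, and makes the isoperimetric inequality
   mu(A) <= C W(boundary of A) true for sparse unions A of cubes: a dyadic cube
   which is sparse in A, but has a child which is not, has many boundary edges,
   by the Poincare inequality on the grid; otherwise one recurses on the
   children.  The coarea formula then gives
     sum_z |U z| mu(z) <= C sum W |U z - U z'|
   for sparsely supported U.  Sparseness is enforced by a cutoff in one
   coordinate, at the price of an error C / L * int |u| M1 mu on a box of size L.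
   As h -> 0 the averages converge to u in L^1 on boxes, hence mu-almost
   everywhere along a subsequence because mu << Lebesgue; conclude with Fatou's
   lemma, and let L -> oo. *)
Require Import Defs.
From mathcomp Require Import all_boot all_order all_algebra.
From mathcomp Require Import all_classical all_reals all_analysis.
From mathcomp Require Import measurable_realfun zify ring lra.

Set Implicit Arguments.
Unset Strict Implicit.
Unset Printing Implicit Defensive.

Import Order.TTheory GRing.Theory Num.Theory.
Import numFieldNormedType.Exports.

Local Open Scope ring_scope.

(** * The inequality on a finite grid *)

(** The weight is known only as a supremum over balls, so it enters through pointwise lower bounds
    alone: a set Q inside the ball of radius rho about x satisfies mu(Q) <= 2^n rho^(n-1) (M1
    mu)(x). This is why the test fields are localized at single edges: a coefficient has to be
    compared with [M1 mu] only at points next to its edge. For a dyadic cube of side 2^j h one takes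
    rho = (n+1) 2^j h, and the factor 2^(-j(n-1)) in W leaves h^(n-1) at every scale; taking a
    maximum and not a sum over j keeps the bound free of the number of scales. The same factor is
    what isoperimetry requires, since 2^(j(n-1)) is the number of edges crossing a section of the
    cube. The final constant is the product of 2^(n+2) from isoperimetry, n 2^(n-1) from the size of
    the fields, and 2^n (n+1)^(n-1) from the balls. None of them depends on h or on the box, which
    permits both limits. The error of the cutoff also scales correctly: its slope is 4/N for N cells
    per direction, the sum of W |U| is of order 1/h, and N h is the side of the box. *)

Section discrete_coarea.
Context {R : realFieldType} {T E : finType}.
Variables (m : T -> R) (src dst : E -> T) (W : E -> R) (S : {set T}).

(** Induction on the number of points where [U] is positive. Let t be the least positive value and A
    the set where [U] is positive. Since U >= t on A and U = 0 off A, the difference of [U] across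
    any edge is, in absolute value, exactly the sum of those of t 1_A and of U - t 1_A; so the
    inequality for sets adds up to the inequality for functions. *)
Lemma discrete_coarea :
  (forall A : {set T}, A \subset S -> \sum_(z in A) m z <=
    \sum_e W e * `|(src e \in A)%:R - (dst e \in A)%:R|) ->
  forall U : T -> R, (forall z, 0 <= U z) -> (forall z, z \notin S -> U z = 0) ->
  \sum_z U z * m z <= \sum_e W e * `|U (src e) - U (dst e)|.
Proof.
move=> HA U; have [k] := ubnP #|[set z | 0 < U z]|.
elim: k U => // k IH U; rewrite ltnS => Uk U0 US.
set A := [set z | 0 < U z] in Uk.
have UA z : z \notin A -> U z = 0.
  by rewrite inE lt_neqAle U0 andbT negbK => /eqP.
have [A0|[z0 z0A]] := finset.set_0Vmem A.
  rewrite (eq_bigr (fun=> 0)) => [|z _]; last by rewrite UA ?mul0r// A0 inE.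
  rewrite big1// big1// => e _; rewrite !UA ?A0 ?inE//.
  by rewrite subrr normr0 mulr0.
pose z1 := [arg min_(z < z0 | z \in A) U z]%O.
have [z1A z1m] : z1 \in A /\ forall z, z \in A -> U z1 <= U z.
  by rewrite /z1; case: arg_minP.
pose t := U z1; have t0 : 0 < t by move: z1A; rewrite inE.
pose U' z : R := U z - t * (z \in A)%:R.
have U'0 z : 0 <= U' z.
  rewrite /U'; case: (boolP (z \in A)) => zA; last by rewrite mulr0 subr0.
  by rewrite mulr1 subr_ge0 z1m.
have U'k : (#|[set z | (0 < U' z)%R]| < k)%N.
  apply: leq_trans Uk; apply: proper_card; apply/properP; split.
    apply/fintype.subsetP => z; rewrite !inE; apply: contraTT => zA.
    by rewrite /U' (negbTE (_ : z \notin A)) ?inE// mulr0 subr0.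
  exists z1 => //; rewrite inE /U' z1A mulr1 subrr ltxx//.
have AS : A \subset S.
  apply/fintype.subsetP => z; apply: contraTT => /US zS.
  by rewrite inE zS ltxx.
have U'S z : z \notin S -> U' z = 0.
  move=> zS; rewrite /U' US// (negbTE (_ : z \notin A)) ?mulr0 ?subr0//.
  by apply: contra zS; exact: (fintype.subsetP AS).
have := lerD (IH U' U'k U'0 U'S) (ler_wpM2l (ltW t0) (HA A AS)).
rewrite !mulr_sumr [X in _ + X <= _]big_mkcond/= -!big_split/=.
set a := (X in X <= _); set b := (X in _ <= X).
have -> : a = \sum_z U z * m z.
  apply: eq_bigr => z _; rewrite /U'; case: ifP => _.
    by rewrite mulr1 mulrBl addrNK.
  by rewrite mulr0 subr0 addr0.
suff -> : b = \sum_e W e * `|U (src e) - U (dst e)| by [].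
apply: eq_bigr => e _; rewrite mulrCA -mulrDr; congr (_ * _).
have UgA z : z \in A -> t <= U z by exact: z1m.
rewrite /U'; case: (boolP (src e \in A)) => sA; case: (boolP (dst e \in A)) => dA;
  rewrite ?mulr1n ?mulr0n ?mulr1 ?mulr0 ?subr0 ?sub0r.
- by rewrite subrr normr0 mulr0 addr0 opprB addrA subrK.
- rewrite (UA _ dA) !subr0 normr1 mulr1.
  by rewrite !ger0_norm ?subr_ge0 ?UgA ?U0// subrK.
- rewrite (UA _ sA) !sub0r !normrN normr1 mulr1.
  by rewrite !ger0_norm ?subr_ge0 ?UgA ?U0// subrK.
- by rewrite normr0 mulr0 addr0.
Qed.

End discrete_coarea.

(** * The Poincare inequality on a box of the grid *)

Section grid.
Context {R : realFieldType} {n N : nat}.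
Implicit Types (z x y a b c : {ffun 'I_n -> 'I_N}) (i : 'I_n) (s t : 'I_N).

(* The last cell is its own successor, so it contributes a zero difference. *)
Definition next s : 'I_N := insubd s s.+1.
Definition upd i z s : {ffun 'I_n -> 'I_N} := [ffun k => if k == i then s else z k].
Definition up i z := upd i z (next (z i)).
(** Vertices of a staircase path: [mix 0 x y] is [x], [mix n x y] is [y], and consecutive vertices
    differ in at most one coordinate. *)
Definition mix l x y : {ffun 'I_n -> 'I_N} := [ffun k : 'I_n => if (k < l)%N then y k else x k].

Lemma val_next s : (s.+1 < N)%N -> next s = s.+1 :> nat.
Proof. by move=> sN; rewrite /next val_insubd sN. Qed.

Lemma line_variation (g : 'I_N -> R) (I : pred 'I_N) s t :
  (forall r : 'I_N, (s <= r <= t)%N -> I r) -> (s <= t)%N ->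
  `|g s - g t| <= \sum_(r | I r && I (next r)) `|g r - g (next r)|.
Proof.
move=> HI st.
have tN := ltn_ord t.
have H (k : nat) : (s + k <= t)%N -> `|g s - g (insubd s (s + k)%N)| <=
   \sum_(r | [&& I r, I (next r) & (s <= r < s + k)%N]) `|g r - g (next r)|.
  elim: k => [_|k IH sk].
    rewrite addn0 (_ : insubd s s = s) ?subrr ?normr0 ?sumr_ge0//.
    by apply/val_inj; rewrite val_insubd ltn_ord.
  pose r0 : 'I_N := insubd s (s + k)%N.
  have r0E : r0 = (s + k)%N :> nat.
    by rewrite /r0 val_insubd ifT//; apply: leq_ltn_trans tN; apply: leq_trans sk; rewrite leq_add2l.
  have nE : next r0 = insubd s (s + k.+1)%N.
    have skN : (s + k.+1 < N)%N by exact: leq_ltn_trans sk tN.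
    by apply/val_inj; rewrite /= val_next r0E -addnS ?val_insubd ?skN.
  have sk' : (s + k <= t)%N by apply: leq_trans sk; rewrite leq_add2l.
  rewrite (bigD1 r0)/=; last first.
    rewrite !HI ?r0E ?leq_addr ?sk' ?addnS ?leqnn//.
    by rewrite nE val_insubd (leq_ltn_trans sk)// leq_addr sk.
  rewrite nE addrC.
  have -> : g s - g (insubd s (s + k.+1)%N) = (g s - g r0) + (g r0 - g (insubd s (s + k.+1)%N)) by ring.
  apply: (le_trans (ler_normD _ _)); apply: lerD => //.
  apply: (le_trans (IH sk')); rewrite le_eqVlt; apply/orP; left; apply/eqP.
  apply: eq_bigl => r; case: (I r); case: (I (next r)) => //=.
  rewrite -(inj_eq val_inj)/= r0E addnS ltnS.
  by case: ltngtP; rewrite ?andbF ?andbT.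
have := H (t - s)%N; rewrite subnKC// (_ : insubd s (t : nat) = t); last first.
  by apply/val_inj; rewrite val_insubd tN.
move/(_ (leqnn _))/le_trans; apply.
rewrite [X in X <= _]big_mkcond [X in _ <= X]big_mkcond; apply: ler_sum => r _.
by case: (I r); case: (I (next r)) => //=; case: ifP.
Qed.

Variable (I : 'I_n -> pred 'I_N).
Hypothesis I_itv : forall i (s t r : 'I_N), I i s -> I i t -> (s <= r <= t)%N -> I i r.
Let Q z := [forall i, I i (z i)].

Let Qupd i z s : Q z -> I i s -> Q (upd i z s).
Proof.
move=> /forallP Qz Is; apply/forallP => k; rewrite ffunE; case: eqP => [->//|_].
exact: Qz.
Qed.

Let Qmix l x y : Q x -> Q y -> Q (mix l x y).
Proof.
by move=> /forallP Qx /forallP Qy; apply/forallP => k; rewrite ffunE; case: ifP.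
Qed.

Let updK i z s : upd i (upd i z s) (z i) = z.
Proof. by apply/ffunP => k; rewrite !ffunE; case: eqP => [->|]. Qed.

Let upd_id i z s : upd i z s i = s.
Proof. by rewrite ffunE eqxx. Qed.

(** The map (a, s) -> (upd i a s, a i) is an involution of the pairs; after it, the old coordinate
    is a free index running over [I i]. *)
Let sum_upd i (H : {ffun 'I_n -> 'I_N} -> R) :
  \sum_(a | Q a) \sum_(s | I i s) H (upd i a s) =
  #|I i|%:R * \sum_(a | Q a) H a.
Proof.
have -> : #|I i|%:R * \sum_(a | Q a) H a = \sum_(a | Q a) \sum_(s | I i s) H a.
  by rewrite mulr_sumr; apply: eq_bigr => a _; rewrite sumr_const mulr_natl.
rewrite !pair_big_dep/=.
rewrite (reindex_onto (fun p : {ffun 'I_n -> 'I_N} * 'I_N => (upd i p.1 p.2, p.1 i))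
   (fun p => (upd i p.1 p.2, p.1 i))) /=; last first.
  by move=> [a s] _ /=; rewrite updK upd_id.
apply: eq_big => [[a s]|[a s] _] /=; last by rewrite updK.
rewrite updK upd_id eqxx andbT; apply/andP/andP => -[Qa Ia].
  split; first by rewrite -(updK i a s); apply: Qupd.
  by move/forallP : Qa => /(_ i); rewrite upd_id.
split; first exact: Qupd.
by move/forallP : Qa => /(_ i).
Qed.

Let mixK l x y : mix l (mix l x y) (mix l y x) = x.
Proof. by apply/ffunP => k; rewrite !ffunE; case: (k < l)%N. Qed.

(** Exchanging the first [l] coordinates of [x] and [y] is an involution of the pairs. It makes a
    step of the staircase start at a free point instead of a mixed one. *)
Let sum_mix l (H : {ffun 'I_n -> 'I_N} -> {ffun 'I_n -> 'I_N} -> R) :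
  \sum_(x | Q x) \sum_(y | Q y) H (mix l x y) (mix l y x) =
  \sum_(x | Q x) \sum_(y | Q y) H x y.
Proof.
rewrite !pair_big_dep/=.
rewrite (reindex_onto (fun p => (mix l p.1 p.2, mix l p.2 p.1))
   (fun p => (mix l p.1 p.2, mix l p.2 p.1))) /=; last first.
  by move=> [a s] _ /=; rewrite !mixK.
apply: eq_big => [[a s]|[a s] _] /=; last by rewrite !mixK.
rewrite !mixK eqxx andbT; apply/andP/andP => -[Qa Qs]; last by split; exact: Qmix.
by split; [rewrite -(mixK l a s)|rewrite -(mixK l s a)]; apply: Qmix.
Qed.

Let variation_upd i (f : {ffun 'I_n -> 'I_N} -> R) a t : Q a -> I i t ->
  `|f a - f (upd i a t)| <=
  \sum_(s | I i s) if Q (up i (upd i a s)) then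
     `|f (upd i a s) - f (up i (upd i a s))| else 0.
Proof.
move=> Qa It; have Ia : I i (a i) by have /forallP := Qa.
have H (s t0 : 'I_N) : (s <= t0)%N -> I i s -> I i t0 -> `|f (upd i a s) - f (upd i a t0)| <=
  \sum_(s | I i s) if Q (up i (upd i a s)) then
     `|f (upd i a s) - f (up i (upd i a s))| else 0.
  move=> st0 Is It0.
  have HI (r : 'I_N) : (s <= r <= t0)%N -> I i r by exact: I_itv.
  apply: (le_trans (line_variation (fun s => f (upd i a s)) HI st0)).
  rewrite big_mkcondr; apply: ler_sum => r Ir.
  have E : up i (upd i a r) = upd i a (next r).
    by apply/ffunP => k; rewrite !ffunE eqxx; case: eqP.
  rewrite E; case: ifPn => Inr; last by case: ifP.
  by rewrite ifT//; exact: Qupd.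
have E : upd i a (a i) = a by apply/ffunP => k; rewrite ffunE; case: eqP => [->|].
rewrite -[X in f X - _]E; have [/H|/ltnW/H] := leqP (a i) t; first exact.
by rewrite distrC; exact.
Qed.

(** Follow the staircase from x to y. After the exchange of coordinates its [i]-th step joins x to a
    point of the same line in direction [i], and is bounded by the variation along that line inside
    the box. This bound does not involve y, whence the factor #|Q|, and summing it over x counts
    each edge #|I i| <= K times. *)
Lemma grid_poincare (f : {ffun 'I_n -> 'I_N} -> R) (K : nat) :
  (forall i, #|I i| <= K)%N ->
  \sum_(x | Q x) \sum_(y | Q y) `|f x - f y| <=
  #|Q|%:R * K%:R * \sum_i \sum_(z | Q z && Q (up i z)) `|f z - f (up i z)|.
Proof.
move=> HK.
pose D (l : nat) := \sum_(x | Q x) \sum_(y | Q y) `|f (mix l x y) - f (mix l.+1 x y)|.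
apply: (@le_trans _ _ (\sum_(i < n) D i)).
  rewrite /D [X in _ <= X]exchange_big/=.
  apply: ler_sum => x _; rewrite [X in _ <= X]exchange_big/=; apply: ler_sum => y _.
  have -> : f x - f y = \sum_(i < n) (f (mix i x y) - f (mix i.+1 x y)).
    rewrite -(big_mkord xpredT (fun i : nat => f (mix i x y) - f (mix i.+1 x y))).
    under eq_bigr do rewrite -opprB.
    rewrite sumrN (telescope_sumr (fun i : nat => f (mix i x y)))// opprB; congr (f _ - f _).
      by apply/ffunP => k; rewrite ffunE.
    by apply/ffunP => k; rewrite ffunE ltn_ord.
  exact: ler_norm_sum.
rewrite mulr_sumr; apply: ler_sum => i _.
pose H z := if Q (up i z) then `|f z - f (up i z)| else 0.
have H0 z : 0 <= H z by rewrite /H; case: ifP.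
have -> : D i = \sum_(x | Q x) \sum_(y | Q y) `|f x - f (upd i x (y i))|.
  rewrite -(sum_mix i); apply: eq_bigr => x _; apply: eq_bigr => y _.
  congr (`|_ - f _|); apply/ffunP => k; rewrite !ffunE ltnn ltnS.
  rewrite leq_eqVlt -(inj_eq val_inj)/=; case: eqP => //= ki.
  by rewrite (val_inj ki : k = i).
apply: (@le_trans _ _ (\sum_(x | Q x) \sum_(y | Q y) \sum_(s | I i s) H (upd i x s))).
  apply: ler_sum => x Qx; apply: ler_sum => y /forallP Qy.
  exact: variation_upd.
under eq_bigr do rewrite sumr_const -mulr_natl.
rewrite -mulr_sumr sum_upd mulrA big_mkcondr/=.
apply: ler_wpM2r; first by apply: sumr_ge0 => z _; exact: H0.
by apply: ler_wpM2l; rewrite ?ler_nat.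
Qed.

End grid.

(** * Isoperimetry by descent through dyadic cells *)

Section dyadic_grid.
Context {R : realFieldType} {n J : nat}.
Local Notation T := {ffun 'I_n -> 'I_(2 ^ J)}.
Implicit Types (z x y c d : T) (i : 'I_n).

Definition ord_div j (s : 'I_(2 ^ J)) : 'I_(2 ^ J) :=
  Ordinal (leq_ltn_trans (leq_div s (2 ^ j)) (ltn_ord s)).
(** A dyadic cell of side [2 ^ j] is named by the quotients of its coordinates; keeping these in [T]
    gives the names of all scales one type. *)
Definition cell j z : T := [ffun k => ord_div j (z k)].

Lemma cellP j z c : reflect (forall k, z k %/ 2 ^ j = c k)%N (cell j z == c).
Proof.
apply: (iffP eqP) => [<- k|H]; first by rewrite ffunE.
by apply/ffunP => k; apply/val_inj; rewrite ffunE /= H.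
Qed.

Lemma cell0 z : cell 0 z = z.
Proof. by apply/eqP/cellP => k; rewrite expn0 divn1. Qed.

Lemma cellS j z z' : cell j z = cell j z' -> cell j.+1 z = cell j.+1 z'.
Proof.
move=> /ffunP H; apply/ffunP => k; apply/val_inj; have /(congr1 val) := H k.
by rewrite !ffunE /= expnSr !divnMA => ->.
Qed.

Lemma card_ord_div j (c : 'I_(2 ^ J)) : (#|[pred s | ord_div j s == c]| <= 2 ^ j)%N.
Proof.
have j0 : (0 < 2 ^ j)%N by rewrite expn_gt0.
pose f (s : 'I_(2 ^ J)) : 'I_(2 ^ j) := Ordinal (ltn_pmod s j0).
rewrite -[X in (_ <= X)%N]card_ord -(@card_in_imset _ _ f).
  exact: max_card.
move=> s t; rewrite !inE => /eqP/(congr1 val)/= sc /eqP/(congr1 val)/= tc.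
move=> /(congr1 val)/= st; apply/val_inj.
by rewrite /= (divn_eq s (2 ^ j)) (divn_eq t (2 ^ j)) sc tc st.
Qed.

(** As [j <= J], the cell is not cut by a face of the grid, and all [2 ^ j] remainders occur in each
    coordinate. *)
Lemma card_cell j z0 : (j <= J)%N ->
  ((2 ^ j) ^ n <= #|[pred z | cell j z == cell j z0]|)%N.
Proof.
move=> jJ; have j0 : (0 < 2 ^ j)%N by rewrite expn_gt0.
have fN (k : 'I_n) (y : {ffun 'I_n -> 'I_(2 ^ j)}) :
    ((z0 k %/ 2 ^ j) * 2 ^ j + y k < 2 ^ J)%N.
  have : (z0 k %/ 2 ^ j < 2 ^ (J - j))%N.
    by rewrite ltn_divLR// -expnD subnK.
  rewrite -(leq_pmul2r j0) -expnD subnK//; apply: leq_trans.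
  by rewrite mulSn addnC ltn_add2r.
pose f (y : {ffun 'I_n -> 'I_(2 ^ j)}) : T := [ffun k => Ordinal (fN k y)].
have <- : #|{ffun 'I_n -> 'I_(2 ^ j)}| = ((2 ^ j) ^ n)%N by rewrite card_ffun !card_ord.
rewrite -(@card_imset _ _ f) => [|y y' /ffunP H]; last first.
  apply/ffunP => k; apply/val_inj; have /(congr1 val) := H k.
  by rewrite !ffunE /= => /addnI.
apply: subset_leq_card; apply/fintype.subsetP => _ /imsetP[y _ ->]; rewrite inE.
apply/cellP => k; by rewrite !ffunE /= divnMDl// (@divn_small (y k)) ?addn0.
Qed.

Variables (m : T -> R) (W : 'I_n -> T -> R).
Hypothesis m0 : forall z, 0 <= m z.
Hypothesis W0 : forall i z, 0 <= W i z.
Hypothesis n0 : (0 < n)%N.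
(** The normalization by (2^j)^(n-1) is the one for which a set cutting a fixed proportion of a
    cell, hence having of the order of (2^j)^(n-1) boundary edges in it, pays for the whole mass of
    the cell. *)
Hypothesis mW : forall j i z, (j <= J)%N -> cell j (up i z) = cell j z ->
  \sum_(x | cell j x == cell j z) m x <= (2 ^ j)%:R ^+ n.-1 * W i z.

Let jump (A : {set T}) i z : R := `|(z \in A)%:R - (up i z \in A)%:R|.

Let jump0 A i z : 0 <= jump A i z.
Proof. exact: normr_ge0. Qed.

(** Let q count the points of c, a those in A, and e the boundary edges of A inside c. Poincare for
    the indicator of A gives a (q - a) <= q 2^(j+1) e; sparseness, q <= 2 (q - a), turns it into a
    <= 2^(j+2) e; the dense child gives 2^(jn) <= 2 a. Each of the e edges weighs at least
    2^(-(j+1)(n-1)) times the mass of c, and collecting the powers of 2 leaves j + 3 + (j+1)(n-1) -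
    jn = n + 2. *)
Let isoperimetric_cell (A : {set T}) j c z0 : (j < J)%N ->
  cell j.+1 z0 = c ->
  (2 * #|[pred z | (cell j.+1 z == c) && (z \in A)]| <= #|[pred z | cell j.+1 z == c]|)%N ->
  (#|[pred z | cell j z == cell j z0]| < 2 * #|[pred z | (cell j z == cell j z0) && (z \in A)]|)%N ->
  \sum_(z | cell j.+1 z == c) m z <= 2 ^+ n.+2 *
    \sum_i \sum_(z | (cell j.+1 z == c) && (cell j.+1 (up i z) == c)) W i z * jump A i z.
Proof.
move=> jJ z0c Ac Ad.
set a := #|[pred z | (cell j.+1 z == c) && (z \in A)]| in Ac.
set q := #|[pred z | cell j.+1 z == c]| in Ac.
set M := \sum_(z | _) m z; set S := \sum_i _.
pose e : R := \sum_i \sum_(z | (cell j.+1 z == c) && (cell j.+1 (up i z) == c)) jump A i z.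
have e0 : 0 <= e by apply: sumr_ge0 => i _; apply: sumr_ge0 => z _; exact: normr_ge0.
have M0 : 0 <= M by apply: sumr_ge0.
have q0 : (0 < q)%N by apply/card_gt0P; exists z0; rewrite inE z0c.
have Me : M * e <= (2 ^ j.+1)%:R ^+ n.-1 * S.
  rewrite !mulr_sumr; apply: ler_sum => i _; rewrite !mulr_sumr; apply: ler_sum => z.
  move=> /andP[/eqP zc /eqP uzc]; rewrite mulrA; apply: ler_wpM2r; first exact: jump0.
  by have := @mW j.+1 i z jJ; rewrite zc; exact.
have qe : a%:R * (q - a)%:R <= q%:R * (2 ^ j.+1)%:R * e.
  pose I (i : 'I_n) := [pred s : 'I_(2 ^ J) | ord_div j.+1 s == c i].
  have Iitv i (s t r : 'I_(2 ^ J)) : I i s -> I i t -> (s <= r <= t)%N -> I i r.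
    rewrite !inE => /eqP/(congr1 val)/= sc /eqP/(congr1 val)/= tc /andP[sr rt].
    apply/eqP/val_inj => /=; apply/eqP; rewrite eqn_leq.
    by rewrite -{1}tc -sc !leq_div2r.
  have QE z : [forall i, I i (z i)] = (cell j.+1 z == c).
    apply/forallP/cellP => H k.
      by have := H k; rewrite inE => /eqP/(congr1 val).
    by rewrite inE; apply/eqP/val_inj; exact: H.
  have := grid_poincare Iitv (fun z => (z \in A)%:R : R) (fun i => card_ord_div j.+1 (c i)).
  rewrite (eq_card (_ : _ =1 [pred z | cell j.+1 z == c])) -/q; last first.
    by move=> z; rewrite !unfold_in QE.
  under eq_bigl do rewrite QE.
  under [X in _ <= _ * X]eq_bigr do under eq_bigl do rewrite !QE.
  rewrite -/e; apply: le_trans.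
  rewrite -natrM (_ : (a * (q - a))%N =
     (\sum_(x | (cell j.+1 x == c) && (x \in A)) \sum_(y | (cell j.+1 y == c) && (y \notin A)) 1)%N); last first.
    rewrite sum_nat_const sum1_card; congr (_ * _)%N.
    have := cardID (mem A) [pred z | cell j.+1 z == c].
    rewrite -/q => <-; rewrite (_ : #|[predI _ & _]| = a) ?addKn.
      by apply: eq_card => z; rewrite !inE andbC.
    by apply: eq_card => z; rewrite !inE.
  rewrite natr_sum big_mkcondr; apply: ler_sum => x _; rewrite natr_sum.
  case: ifPn => xA; last by apply: sumr_ge0 => y _; exact: normr_ge0.
  rewrite big_mkcondr [X in _ <= X](eq_bigl _ _ QE).
  apply: ler_sum => y _; case: ifPn => yA; last exact: normr_ge0.
  by rewrite (negbTE yA) subr0 normr1.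
have aq : a%:R <= (2 ^ j.+2)%:R * e.
  have : (q <= 2 * (q - a))%N by rewrite mulnBr; lia.
  rewrite -(ler_nat R) natrM => H.
  have q0' : 0 < q%:R :> R by rewrite ltr0n.
  rewrite -(ler_pM2l q0').
  apply: (le_trans (ler_wpM2r (ler0n _ a) H)).
  rewrite (expnS _ j.+1) natrM (_ : _ * (_ * _ * e) = 2 * (q%:R * (2 ^ j.+1)%:R * e)); last by ring.
  by rewrite -mulrA ler_pM2l// mulrC.
have ja : ((2 ^ j) ^ n <= 2 * a)%N.
  apply: (leq_trans (card_cell z0 (ltnW jJ))); apply: (leq_trans (ltnW Ad)).
  rewrite leq_mul2l/=; apply: subset_leq_card; apply/fintype.subsetP => z; rewrite !inE.
  by move=> /andP[/eqP/cellS -> ->]; rewrite z0c eqxx.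
move: ja; rewrite -(ler_nat R) natrM => ja.
have H : ((2 ^ j) ^ n)%:R <= (2 ^ j.+3)%:R * e.
  by apply: (le_trans ja); rewrite (expnS _ j.+2) natrM -mulrA ler_pM2l.
have p0 : 0 < ((2 ^ j) ^ n)%:R :> R by rewrite ltr0n !expn_gt0.
rewrite -(ler_pM2l p0).
apply: (@le_trans _ _ ((2 ^ j.+3)%:R * (M * e))).
  rewrite (_ : (2 ^ j.+3)%:R * (M * e) = (2 ^ j.+3)%:R * e * M); last by ring.
  exact: ler_wpM2r.
apply: (@le_trans _ _ ((2 ^ j.+3)%:R * ((2 ^ j.+1)%:R ^+ n.-1 * S))).
  by rewrite ler_wpM2l.
rewrite [X in X <= _]mulrA [X in _ <= X]mulrA le_eqVlt; apply/orP; left; apply/eqP; congr (_ * _).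
rewrite !natrX -!exprM -!exprD; congr (2 ^+ _).
by rewrite -(prednK n0)/=; lia.
Qed.

Let bnd0 (A : {set T}) (P : 'I_n -> pred T) :
  0 <= 2 ^+ n.+2 * \sum_i \sum_(z | P i z) W i z * jump A i z.
Proof.
apply: mulr_ge0; first exact: exprn_ge0.
by apply: sumr_ge0 => i _; apply: sumr_ge0 => z _; rewrite mulr_ge0 ?W0 ?jump0.
Qed.

(** A dense child stops the descent: the inner edges of the parent then pay for its whole mass. If
    all children are sparse, the induction hypothesis applies to each of them, and inner edges of
    distinct children are distinct inner edges of the parent. *)
Let isoperimetric_dyadic (A : {set T}) j c : (j <= J)%N ->
  (2 * #|[pred z | (cell j z == c) && (z \in A)]| <= #|[pred z | cell j z == c]|)%N ->
  \sum_(z | (cell j z == c) && (z \in A)) m z <= 2 ^+ n.+2 *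
    \sum_i \sum_(z | (cell j z == c) && (cell j (up i z) == c)) W i z * jump A i z.
Proof.
elim: j c => [|j IH] c jJ Ac.
  (* A cell of side 1 is a single point, and its sparseness means that it is not in [A]. *)
  rewrite big_pred0; first exact: bnd0.
  move=> z; apply/negP => /andP[/eqP zc zA]; move: Ac.
  rewrite [X in (_ <= X)%N](@eq_card _ _ (pred1 c)) ?card1; last by move=> x; rewrite !inE cell0.
  rewrite (@eq_card _ _ (pred1 c)) ?card1// => x; rewrite !inE cell0.
  by case: eqP => [->|//]; rewrite (_ : c = z) ?zA// -zc cell0.
have [/existsP[z0 /andP[/eqP z0c H]]|] := boolP [exists z0, (cell j.+1 z0 == c) &&
  (#|[pred z | cell j z == cell j z0]| < 2 * #|[pred z | (cell j z == cell j z0) && (z \in A)]|)%N].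
  apply: le_trans (isoperimetric_cell jJ z0c Ac H).
  rewrite big_mkcondr; apply: ler_sum => z _; case: ifP => //.
move=> /existsPn H.
rewrite (partition_big (cell j) xpredT)//=.
apply: (@le_trans _ _ (\sum_d 2 ^+ n.+2 * \sum_i \sum_(z | [&& cell j.+1 z == c, cell j z == d & cell j (up i z) == d]) W i z * jump A i z)).
  apply: ler_sum => d _.
  have [/existsP[z0 /andP[/eqP z0c /eqP z0d]]|/existsPn nd] :=
      boolP [exists z0, (cell j.+1 z0 == c) && (cell j z0 == d)]; last first.
    rewrite big_pred0; first exact: bnd0.
    by move=> z; have := nd z; rewrite -andbA andbCA => /nandP[]/negbTE ->; rewrite ?andbF.
  have E z : (cell j z == d) = (cell j.+1 z == c) && (cell j z == d).
    by case: eqP => [|_]; rewrite ?andbF// -z0d => /cellS ->; rewrite z0c eqxx.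
  have := H z0; rewrite z0c eqxx/= -leqNgt z0d => /(IH _ (ltnW jJ)).
  rewrite [X in _ -> X <= _](eq_bigl (fun z => (cell j z == d) && (z \in A))); last first.
    by move=> z; rewrite [in RHS]E -!andbA; congr (_ && _); rewrite andbC.
  move=> IHd; apply: (le_trans IHd); rewrite ler_pM2l ?exprn_gt0//.
  apply: ler_sum => i _; rewrite le_eqVlt; apply/orP; left; apply/eqP.
  by apply: eq_bigl => z; rewrite [in LHS]E -andbA.
rewrite -mulr_sumr ler_pM2l ?exprn_gt0// exchange_big/=; apply: ler_sum => i _.
rewrite [X in _ <= X](partition_big (cell j) xpredT)//=.
apply: ler_sum => d _.
rewrite [X in X <= _]big_mkcond [X in _ <= X]big_mkcond; apply: ler_sum => z _.
have g0 : 0 <= W i z * jump A i z by rewrite mulr_ge0 ?W0 ?jump0.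
case: ifPn => [/and3P[/eqP zc /eqP zd /eqP ud]|_]; last by case: ifP.
rewrite zc zd !eqxx/= ifT// andbT -zc; apply/eqP; apply: cellS.
by rewrite ud zd.
Qed.

(* The factor [2] in the support condition makes the root cell sparse, which
   starts the induction; [U] need not vanish on the faces of the grid. *)
Lemma discrete_weighted_sobolev (S : {set T}) (U : T -> R) :
  (2 * #|S| <= #|{: T}|)%N ->
  (forall z, 0 <= U z) -> (forall z, z \notin S -> U z = 0) ->
  \sum_z U z * m z <= 2 ^+ n.+2 * \sum_i \sum_z W i z * `|U z - U (up i z)|.
Proof.
move=> ST U0 US.
rewrite mulr_sumr; under [X in _ <= X]eq_bigr do rewrite mulr_sumr.
rewrite pair_big/=; under [X in _ <= X]eq_bigr do rewrite mulrA.
apply: (@discrete_coarea _ _ _ m (fun p : 'I_n * T => p.2) (fun p => up p.1 p.2)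
  (fun p => 2 ^+ n.+2 * W p.1 p.2) S) => // A AS.
(* At scale [J] the whole grid is one cell, so every edge is an inner edge of it. *)
have cJ z z' : cell J z = cell J z'.
  by apply/ffunP => k; apply/val_inj; rewrite !ffunE/= !divn_small.
have [T0|[z0 _]] := finset.set_0Vmem [set: T].
  rewrite big1 ?sumr_ge0// => [p _|z]; last by have := finset.in_setT z; rewrite T0 inE.
  by apply: mulr_ge0 => //; apply: mulr_ge0; [exact: exprn_ge0|exact: W0].
have E z : cell J z == cell J z0 by rewrite (cJ z z0).
have card_half : (2 * #|[pred z | (cell J z == cell J z0) && (z \in A)]| <=
    #|[pred z | cell J z == cell J z0]|)%N.
  apply: (@leq_trans (2 * #|S|)); first by rewrite leq_mul2l; apply/subset_leq_card/fintype.subsetP => z;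
    rewrite inE => /andP[_]; exact: (fintype.subsetP AS).
  by apply: (leq_trans ST); apply: subset_leq_card; apply/fintype.subsetP => z _; rewrite inE E.
have := isoperimetric_dyadic (leqnn J) card_half.
rewrite (eq_bigl (mem A)) => [|z]; last by rewrite E.
move/le_trans; apply; rewrite le_eqVlt; apply/orP; left; apply/eqP.
rewrite mulr_sumr; under eq_bigr do rewrite mulr_sumr.
rewrite -(pair_big xpredT xpredT (fun i z => 2 ^+ n.+2 * W i z * jump A i z))/=.
apply: eq_bigr => i _; apply: eq_big => [z|z _]; first by rewrite !E.
by rewrite mulrA.
Qed.

End dyadic_grid.

Local Open Scope classical_set_scope.
Local Open Scope ring_scope.

(** * Smooth test fields supported in two neighbouring cubes *)

Lemma continuous_mx (R : realType) n p q (f : 'rV[R]_n -> 'M[R]_(p, q)) :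
  (forall i j, continuous (fun x => f x i j)) -> continuous f.
Proof.
move=> cf x; have FF := nbhs_filter (x : 'rV[R]_n).
apply: (iffRL (@cvgrPdist_le _ _ _ _ FF _ _)) => /= e e0.
have H : \forall y \near nbhs (x : 'rV[R]_n), forall ij : 'I_p * 'I_q,
    `|f x ij.1 ij.2 - f y ij.1 ij.2| <= e.
  apply: filter_forall => -[i j].
  exact: (iffLR (@cvgrPdist_le _ _ _ _ FF _ _) (cf i j x)).
apply: filterS H => y H.
rewrite [leLHS]/Num.Def.normr/= mx_normrE (bigmax_le _ (ltW e0))//= => -[i j] _.
by rewrite [in leLHS]mxE/= [X in _ + X]mxE; exact: (H (i, j)).
Qed.

Section C1_functions.
Context {R : realType} {n : nat}.
Implicit Types (f g : 'rV[R]_n -> R) (v x : 'rV[R]_n).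

(** Directional derivatives are convenient here because the rules for sums and products apply to
    them directly; [C1_continuously_differentiable] returns to the Jacobian. *)
Definition C1 f :=
  (forall x, differentiable f x) /\ (forall v, continuous (fun x => 'D_v f x)).

Lemma C1_cst (c : R) : C1 (fun=> c).
Proof.
split=> [x|v]; first exact: differentiable_cst.
under eq_fun do rewrite derive_cst; apply: cst_continuous.
Qed.

Lemma C1D f g : C1 f -> C1 g -> C1 (fun x => f x + g x).
Proof.
move=> [df cf] [dg cg]; split=> [x|v]; first exact: differentiableD.
rewrite (_ : (fun x => _) = (fun x => 'D_v f x + 'D_v g x)).
  by move=> x; exact: (cvgD (cf v x) (cg v x)).
by apply/funext => x; rewrite deriveD//; exact: diff_derivable.
Qed.

Lemma C1M f g : C1 f -> C1 g -> C1 (fun x => f x * g x).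
Proof.
move=> [df cf] [dg cg]; split=> [x|v]; first exact: differentiableM.
rewrite (_ : (fun x => _) = (fun x => f x * 'D_v g x + g x * 'D_v f x)).
  move=> x; apply: (cvgD (cvgM _ (cg v x)) (cvgM _ (cf v x))).
    exact: differentiable_continuous.
  exact: differentiable_continuous.
by apply/funext => x; rewrite deriveM//; exact: diff_derivable.
Qed.

Lemma C1_sum (I : Type) (r : seq I) (P : pred I) (F : I -> 'rV[R]_n -> R) :
  (forall i, C1 (F i)) -> C1 (fun x => \sum_(i <- r | P i) F i x).
Proof.
move=> H; elim: r => [|i r IH].
  by under eq_fun do rewrite big_nil; exact: C1_cst.
under eq_fun do rewrite big_cons.
by case: (P i) => //; exact: C1D.
Qed.

Lemma C1_prod (I : Type) (r : seq I) (P : pred I) (F : I -> 'rV[R]_n -> R) :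
  (forall i, C1 (F i)) -> C1 (fun x => \prod_(i <- r | P i) F i x).
Proof.
move=> H; elim: r => [|i r IH].
  by under eq_fun do rewrite big_nil; exact: C1_cst.
under eq_fun do rewrite big_cons.
by case: (P i) => //; exact: C1M.
Qed.

Lemma derive_coord (g dg : R -> R) (j : 'I_n) x v :
  (forall t : R, is_derive t 1 g (dg t)) ->
  differentiable (fun y : 'rV[R]_n => g (y ord0 j)) x /\
  'D_v (fun y : 'rV[R]_n => g (y ord0 j)) x = dg (x ord0 j) * v ord0 j.
Proof.
move=> Hg.
have dg1 (t : R) : differentiable g t by apply/derivable1_diffP.
have dc : differentiable (fun y : 'rV[R]_n => y ord0 j) x by exact: differentiable_coord.
have dgc : differentiable (g \o (fun y : 'rV[R]_n => y ord0 j)) x.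
  exact: differentiable_comp.
split=> //; rewrite (deriveE _ dgc) diff_comp//=.
rewrite -(deriveE _ dc) deriv1E//=.
have -> : 'D_v (fun y : 'rV[R]_n => y ord0 j) x = v ord0 j.
  have did : derivable (@idfun 'rV[R]_n) x v by exact: derivable_id.
  by have /(congr1 (fun M : 'rV[R]_n => M ord0 j)) := derive_mx did;
    rewrite derive_id mxE => ->.
by rewrite [RHS]mulrC derive1E derive_val.
Qed.

Lemma C1_coord (g dg : R -> R) (j : 'I_n) :
  (forall t : R, is_derive t 1 g (dg t)) -> continuous dg ->
  C1 (fun y : 'rV[R]_n => g (y ord0 j)).
Proof.
move=> Hg cdg; split=> [x|v]; first exact: (derive_coord j x 0 Hg).1.
rewrite (_ : (fun x => _) = (fun x => dg (x ord0 j) * v ord0 j)).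
  have H : continuous (fun x : 'rV[R]_n => dg (x ord0 j)).
    move=> x; apply: (@continuous_comp _ _ _ (fun x : 'rV[R]_n => x ord0 j) dg); last exact: cdg.
    exact: coord_continuous.
  by move=> x; apply: (continuousM (H x)); apply: cst_continuous.
by apply/funext => x; rewrite (derive_coord j x v Hg).2.
Qed.

Lemma derive_prod_coord (g dg : 'I_n -> R -> R) (i : 'I_n) x :
  (forall j (t : R), is_derive t 1 (g j) (dg j t)) -> (forall j, continuous (dg j)) ->
  'D_(delta_mx ord0 i) (fun y : 'rV[R]_n => \prod_j g j (y ord0 j)) x =
  dg i (x ord0 i) * \prod_(j | j != i) g j (x ord0 j).
Proof.
move=> Hg cdg.
have C j : C1 (fun y : 'rV[R]_n => g j (y ord0 j)) by exact: C1_coord (Hg j) (cdg j).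
under eq_fun do rewrite (bigD1 i)//=.
have C' (r : seq 'I_n) : C1 (fun y : 'rV[R]_n => \prod_(j <- r | j != i) g j (y ord0 j)).
  exact: C1_prod.
have D0 (r : seq 'I_n) : 'D_(delta_mx ord0 i)
    (fun y : 'rV[R]_n => \prod_(j <- r | j != i) g j (y ord0 j)) x = 0.
  elim: r => [|j r IH]; first by under eq_fun do rewrite big_nil; rewrite derive_cst.
  under eq_fun do rewrite big_cons.
  case: eqVneq => //= ji; rewrite deriveM; first last.
  - by apply: diff_derivable; exact: (C' r).1.
  - by apply: diff_derivable; exact: (C j).1.
  rewrite IH (derive_coord j x _ (Hg j)).2 mxE eqxx (negbTE ji) mulr0.
  by rewrite !scaler0 addr0.
rewrite deriveM; first last.
- by apply: diff_derivable; exact: (C' _).1.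
- by apply: diff_derivable; exact: (C i).1.
rewrite D0 scaler0 add0r (derive_coord i x _ (Hg i)).2 mxE !eqxx mulr1.
by rewrite [LHS]mulrC.
Qed.

Lemma C1_continuously_differentiable (F : 'I_n -> 'rV[R]_n -> R) :
  (forall i, C1 (F i)) -> continuously_differentiable (fun x => \row_i F i x).
Proof.
move=> CF.
have dF x : differentiable (fun x => \row_i F i x : 'rV[R]_n) x.
  rewrite (_ : (fun x => _) = (fun x => \sum_i F i x *: (delta_mx ord0 i : 'rV[R]_n))).
    have := @differentiable_sum _ _ _ n (fun i x => F i x *: (delta_mx ord0 i : 'rV[R]_n)) x.
    rewrite fct_sumE; apply => i.
    by apply: differentiableZl; exact: (CF i).1.
  by apply/funext => y; rewrite [LHS]row_sum_delta; apply: eq_bigr => i _; rewrite mxE.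
split=> //; apply: continuous_mx => i j.
rewrite (_ : (fun x => _) = (fun x => 'D_(delta_mx ord0 i) (F j) x)); first exact: (CF j).2.
apply/funext => y.
rewrite /jacobian mxE -deriveE// derive_mx; last exact: diff_derivable.
rewrite mxE (_ : delta_mx _ _ = delta_mx ord0 i); last by apply/rowP => k; rewrite !mxE.
by congr ('D__ _ _); apply/funext => z; rewrite mxE.
Qed.

End C1_functions.

(** * A polynomial bump and its primitive *)

Section bump.
Context {R : realType}.
(** Truncated powers. Exponent 0 gives the constant 1, even to the left of [c], and the derivative
    at the knot [c] exists from exponent 2 on; hence the shifted exponents in the lemmas. *)
Definition pospow (c : R) k (s : R) : R := Num.max 0 (s - c) ^+ k.

Lemma pospow_le (c : R) k s : s <= c -> pospow c k.+1 s = 0.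
Proof. by move=> sc; rewrite /pospow max_l ?subr_le0// expr0n. Qed.

Lemma pospow_ge (c : R) k s : c <= s -> pospow c k s = (s - c) ^+ k.
Proof. by move=> sc; rewrite /pospow max_r ?subr_ge0. Qed.

Lemma is_derive_pospow (c : R) k (s : R) :
  is_derive s 1 (pospow c k.+2) (k.+2%:R * pospow c k.+1 s).
Proof.
have [sc|cs|->] := ltgtP s c.
- rewrite pospow_le ?ltW// mulr0.
  apply: (@near_eq_is_derive _ _ _ (cst 0 : R -> R)).
  near=> t; rewrite /= pospow_le// ltW//.
  by near: t; exact: lt_nbhsl.
- rewrite pospow_ge ?(ltW cs)//.
  apply: (@near_eq_is_derive _ _ _ (fun t : R => (t - c) ^+ k.+2)).
  + near=> t; rewrite pospow_ge// ltW//.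
    by near: t; exact: lt_nbhsr.
  + have D : is_derive s 1 (fun t : R => t - c) 1.
      by apply: is_derive_eq; rewrite subr0.
    have := is_deriveX k.+2 D; rewrite [_ *: _]mulr1.
    by rewrite (_ : (fun t => _) ^+ _ = fun t => (t - c) ^+ k.+2)// exprfctE.
(* At the knot the difference quotient vanishes on the left and equals [h ^+ k.+1] on the right. *)
- rewrite pospow_le// mulr0.
  have H : (fun h : R => h^-1 *: (pospow c k.+2 (h *: 1 + c) - pospow c k.+2 c)) @ 0^' --> (0 : R).
    apply/cvgrPdist_le => /= e e0; near=> h.
    rewrite (pospow_le k.+1 (lexx c)) subr0 sub0r normrN [h *: 1]mulr1.
    have h0 : h != 0 by near: h; exact: nbhs_dnbhs_neq.
    have [hle|hgt] := leP h 0.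
      by rewrite pospow_le ?gerDr// scaler0 normr0 ltW.
    rewrite pospow_ge ?lerDr ?(ltW hgt)// addrK exprS [_ *: _]mulrA mulVf// mul1r.
    rewrite ger0_norm ?exprn_ge0 ?(ltW hgt)//.
    apply: (@le_trans _ _ h).
      rewrite exprS ler_piMr ?(ltW hgt)// exprn_ile1 ?(ltW hgt)//.
      apply: le_trans (ler_norm _) _; near: h; exact: dnbhs0_le.
    by apply: le_trans (ler_norm _) _; near: h; exact: dnbhs0_le.
  by apply: DeriveDef; [apply/cvg_ex; exists 0|exact: cvg_lim].
Unshelve. all: by end_near. Qed.

Lemma continuous_pospow (c : R) k : continuous (pospow c k.+1).
Proof.
move=> s; apply: (@continuous_comp _ _ _ (fun s : R => Num.max 0 (s - c)) (fun t => t ^+ k.+1)).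
  apply: (@continuous_max _ _ (fun=> 0) (fun t : R => t - c)); first exact: cst_continuous.
  by apply: cvgB; [exact: cvg_id|exact: cvg_cst].
exact: exprn_continuous.
Qed.

(* On [0, 1], [spline_prim s] is 10 s^3 - 15 s^4 + 6 s^5 and [spline s], its
   derivative, is 30 s^2 (1 - s)^2; truncated powers glue these polynomials to
   constants outside [0, 1]. *)
Definition spline (s : R) : R :=
  30 * (pospow 0 2 s - 2 * pospow 0 3 s + pospow 0 4 s
        - (pospow 1 2 s + 2 * pospow 1 3 s + pospow 1 4 s)).

Definition spline_prim (s : R) : R :=
  10 * pospow 0 3 s - 15 * pospow 0 4 s + 6 * pospow 0 5 s
  - (10 * pospow 1 3 s + 15 * pospow 1 4 s + 6 * pospow 1 5 s).

Definition spline_deriv (s : R) : R :=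
  30 * (2 * pospow 0 1 s - 2 * (3 * pospow 0 2 s) + 4 * pospow 0 3 s
        - (2 * pospow 1 1 s + 2 * (3 * pospow 1 2 s) + 4 * pospow 1 3 s)).

Lemma is_derive_spline_prim (s : R) : is_derive s 1 spline_prim (spline s).
Proof.
have D (c : R) k := is_derive_pospow c k s.
rewrite /spline_prim.
apply: is_derive_eq.
rewrite /spline /GRing.scale/=; ring.
Qed.

Lemma is_derive_spline (s : R) : is_derive s 1 spline (spline_deriv s).
Proof.
have D (c : R) k := is_derive_pospow c k s.
rewrite /spline; apply: is_derive_eq.
rewrite /spline_deriv /GRing.scale/=; ring.
Qed.

Lemma continuous_spline_deriv : continuous spline_deriv.
Proof.
have C (c : R) k := @continuous_pospow c k.
have M (a : R) f : continuous f -> continuous (fun s : R => a * f s).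
  by move=> cf s; apply: cvgM; [exact: cvg_cst|exact: cf].
have Dc (f g : R -> R) : continuous f -> continuous g -> continuous (fun s : R => f s + g s).
  by move=> cf cg s; apply: cvgD; [exact: cf|exact: cg].
have Nc (f : R -> R) : continuous f -> continuous (fun s : R => - f s).
  by move=> cf s; apply: cvgN; exact: cf.
exact: (M 30 _ (Dc _ _ (Dc _ _ (Dc _ _ (M 2 _ (C 0 0%N)) (Nc _ (M 2 _ (M 3 _ (C 0 1%N))))) (M 4 _ (C 0 2%N)))
  (Nc _ (Dc _ _ (Dc _ _ (M 2 _ (C 1 0%N)) (M 2 _ (M 3 _ (C 1 1%N)))) (M 4 _ (C 1 2%N)))))).
Qed.

Lemma spline_out (s : R) : (s <= 0) || (1 <= s) -> spline s = 0.
Proof.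
case/orP => s0; rewrite /spline; first by rewrite !pospow_le//; [lra|lra..].
by rewrite !pospow_ge//; [ring|lra..].
Qed.

Lemma spline_in (s : R) : 0 <= s <= 1 -> spline s = 30 * (s * (1 - s)) ^+ 2.
Proof.
case/andP => s0 s1; rewrite /spline !(@pospow_ge 0)// !pospow_le//; ring.
Qed.

Lemma spline_ge0 s : 0 <= spline s.
Proof.
have [s0|s0] := leP s 0; first by rewrite spline_out ?s0.
have [s1|s1] := leP 1 s; first by rewrite spline_out ?s1 ?orbT.
by rewrite spline_in ?(ltW s0) ?(ltW s1)// mulr_ge0// sqr_ge0.
Qed.

(** The maximum is 30/16, attained at 1/2. The rounded bound 2 is the origin of all powers of
    [2 / h] below. *)
Lemma spline_le s : spline s <= 2.
Proof.
have [s0|s0] := leP s 0; first by rewrite spline_out ?s0.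
have [s1|s1] := leP 1 s; first by rewrite spline_out ?s1 ?orbT.
rewrite spline_in ?(ltW s0) ?(ltW s1)//.
have : 0 <= s * (1 - s) <= 4^-1.
  apply/andP; split; first by rewrite mulr_ge0 ?subr_ge0 ?ltW.
  have := sqr_ge0 (s - 2^-1); rewrite expr2; lra.
case/andP => x0 x1; apply: (@le_trans _ _ (30 * (4^-1) ^+ 2)); last lra.
by apply: ler_wpM2l => //; rewrite !expr2; apply: ler_pM.
Qed.

Lemma spline_prim_le0 s : s <= 0 -> spline_prim s = 0.
Proof. by move=> s0; rewrite /spline_prim !pospow_le//; [ring|lra..]. Qed.

Lemma spline_prim_ge1 s : 1 <= s -> spline_prim s = 1.
Proof. by move=> s0; rewrite /spline_prim !pospow_ge//; [ring|lra..]. Qed.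

Lemma spline_prim_nd : {homo spline_prim : s t / s <= t}.
Proof.
move=> s t st.
have D (x : R) := is_derive_spline_prim x.
have d1 x : x \in `]s, t[%R -> derivable spline_prim x 1 by move=> _; case: (D x).
have d2 x : x \in `]s, t[%R -> 0 <= derive1 spline_prim x.
  by move=> _; rewrite derive1E (@derive_val _ _ _ _ _ _ _ (D x)); exact: spline_ge0.
have c : {within `[s, t], continuous spline_prim}.
  apply: continuous_subspaceT => x; apply/differentiable_continuous/derivable1_diffP.
  by case: (D x).
exact: (ger0_derive1_ndecr d1 d2 c (lexx s) st (lexx t)).
Qed.

End bump.

Section scaled_bump.
Context {R : realType}.
Variables (a h : R).
Hypothesis h0 : 0 < h.

(** A probability density on [a + h k, a + h (k+1)]; [sprim k] is its distribution function. *)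
Definition sbump (k : nat) (t : R) : R := h^-1 * spline ((t - a) / h - k%:R).
Definition sprim (k : nat) (t : R) : R := spline_prim ((t - a) / h - k%:R).

Let is_derive_scale (f df : R -> R) k (t : R) :
  (forall s : R, is_derive s 1 f (df s)) ->
  is_derive t 1 (fun t => f ((t - a) / h - k%:R)) (h^-1 * df ((t - a) / h - k%:R)).
Proof.
move=> Hf; rewrite mulrC.
have D : is_derive t 1 (fun t : R => (t - a) / h - k%:R) h^-1.
  apply: is_derive_eq; rewrite /GRing.scale/=; ring.
exact: is_derive1_comp.
Qed.

Lemma is_derive_sprim k (t : R) : is_derive t 1 (sprim k) (sbump k t).
Proof. by apply: is_derive_scale => s; exact: is_derive_spline_prim. Qed.

Lemma is_derive_sbump k : exists2 d : R -> R,
  continuous d & forall t : R, is_derive t 1 (sbump k) (d t).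
Proof.
exists (fun t => h^-1 * (h^-1 * spline_deriv ((t - a) / h - k%:R))).
  move=> t; apply: cvgM; first exact: cvg_cst.
  apply: cvgM; first exact: cvg_cst.
  apply: (@continuous_comp _ _ _ (fun t => (t - a) / h - k%:R) spline_deriv); last exact: continuous_spline_deriv.
  apply: cvgB; last exact: cvg_cst.
  apply: cvgM; last exact: cvg_cst.
  by apply: cvgB; [exact: cvg_id|exact: cvg_cst].
move=> t; apply: is_deriveZ.
by apply: is_derive_scale => s; exact: is_derive_spline.
Qed.

Lemma continuous_sbump k : continuous (sbump k).
Proof.
have [d _ D] := is_derive_sbump k.
by move=> t; apply/differentiable_continuous/derivable1_diffP; case: (D t).
Qed.

Lemma continuous_sprim k : continuous (sprim k).
Proof.
by move=> t; apply/differentiable_continuous/derivable1_diffP; case: (is_derive_sprim k t).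
Qed.

Lemma sbump_ge0 k t : 0 <= sbump k t.
Proof. by rewrite mulr_ge0 ?spline_ge0// invr_ge0 ltW. Qed.

Lemma sbump_le k t : sbump k t <= 2 / h.
Proof. by rewrite /sbump [h^-1 * _]mulrC ler_pM2r ?invr_gt0// spline_le. Qed.

Let scale_le k t : ((t - a) / h - k%:R <= 0) = (t <= a + h * k%:R).
Proof. by rewrite subr_le0 ler_pdivrMr// lerBlDl [k%:R * h]mulrC. Qed.

Let scale_ge k t : (1 <= (t - a) / h - k%:R) = (a + h * k.+1%:R <= t).
Proof.
by rewrite lerBrDr -[1 + _]mulrS ler_pdivlMr// lerBrDl [_ * h]mulrC.
Qed.

Lemma sbump_out k t : (t <= a + h * k%:R) || (a + h * k.+1%:R <= t) -> sbump k t = 0.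
Proof. by rewrite -scale_le -scale_ge => /spline_out; rewrite /sbump => ->; rewrite mulr0. Qed.

Lemma sprim_le k t : t <= a + h * k%:R -> sprim k t = 0.
Proof. by rewrite -scale_le => /spline_prim_le0. Qed.

Lemma sprim_ge k t : a + h * k.+1%:R <= t -> sprim k t = 1.
Proof. by rewrite -scale_ge => /spline_prim_ge1. Qed.

Lemma sprim_nd k : {homo sprim k : s t / s <= t}.
Proof.
by move=> s t st; apply: spline_prim_nd; rewrite lerD2r ler_pM2r ?invr_gt0// lerD2r.
Qed.

Lemma sprim_itv01 k t : 0 <= sprim k t <= 1.
Proof.
apply/andP; split.
  have [tk|/ltW tk] := leP t (a + h * k%:R); first by rewrite sprim_le.
  by rewrite -(sprim_le (lexx (a + h * k%:R))) sprim_nd.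
have [tk|/ltW tk] := leP (a + h * k.+1%:R) t; first by rewrite sprim_ge.
by rewrite -(sprim_ge (lexx (a + h * k.+1%:R))) sprim_nd.
Qed.

Lemma integral_sbump k :
  (\int[lebesgue_measure]_t (sbump k t)%:E = 1)%E.
Proof.
pose l := a + h * k%:R; pose r := a + h * k.+1%:R.
have lr : l < r by rewrite ltrD2l ltr_pM2l// ltr_nat.
rewrite (_ : (\int[_]_t _)%E = (\int[lebesgue_measure]_(t in `[l, r]) (sbump k t)%:E)%E); last first.
  rewrite [RHS]integral_mkcond; apply: eq_integral => t _.
  rewrite patchE; case: ifPn => //; rewrite notin_setE /= in_itv/= => /negP.
  by rewrite negb_and -!ltNge => /orP[/ltW|/ltW] tl; rewrite sbump_out// tl ?orbT.
rewrite (@continuous_FTC2 _ (sbump k) (sprim k) l r)//.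
- by rewrite sprim_ge// sprim_le// sube0.
- by apply: continuous_subspaceT; exact: continuous_sbump.
- split=> [t _||]; first by case: (is_derive_sprim k t).
  + by apply: cvg_at_right_filter; exact: continuous_sprim.
  + by apply: cvg_at_left_filter; exact: continuous_sprim.
- by move=> t _; rewrite derive1E (@derive_val _ _ _ _ _ _ _ (is_derive_sprim k t)).
Qed.
End scaled_bump.

(** * Product integrals and half-open cubes *)

Lemma measurable_prod_coord {R : realType} n (g : 'I_n -> R -> R) :
  (forall i, measurable_fun setT (g i)) ->
  measurable_fun setT (fun x : 'rV[R]_n => \prod_i g i (x ord0 i)).
Proof.
move=> mg; apply: measurable_prod => i _.
exact: (measurableT_comp (mg i) (measurable_coord i)).
Qed.

(** Tonelli, one coordinate at a time, along the recursive construction of [lebesgue_rV] as the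
    image of a product measure. *)
Lemma integral_prod_coord {R : realType} n (g : 'I_n -> R -> R) :
  (forall i, measurable_fun setT (g i)) -> (forall i t, 0 <= g i t) ->
  (\int[lebesgue_rV n]_x (\prod_i g i (x ord0 i))%:E =
   \prod_i \int[lebesgue_measure]_t (g i t)%:E)%E.
Proof.
elim: n g => [|n IH] g mg g0.
  rewrite /= integral_dirac//.
    by rewrite diracE mem_set// mul1e !big_ord0.
  by apply/measurable_EFinP; exact: measurable_prod_coord.
have mG : measurable_fun setT (fun x : 'rV[R]_n.+1 => (\prod_i g i (x ord0 i))%:E).
  by apply/measurable_EFinP; exact: measurable_prod_coord.
rewrite [LHS](@ge0_integral_pushforward _ _ _ _ _ _ (@measurable_consrV R n)
  (lebesgue_measure \x lebesgue_rV n)%E setT)//; last first.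
  by move=> x _; rewrite lee_fin; apply: prodr_ge0 => i _.
rewrite preimage_setT.
have GE : (fun x : 'rV[R]_n.+1 => (\prod_i g i (x ord0 i))%:E) \o @consrV R n =
  (fun p => (g ord0 p.1)%:E * (\prod_i g (lift ord0 i) (p.2 ord0 i))%:E)%E.
  apply/funext => -[t y] /=; rewrite big_ord_recl -EFinM mxE unlift_none/=.
  by congr ((_ * _)%:E); apply: eq_bigr => i _; rewrite mxE liftK.
have mGc := measurableT_comp mG (@measurable_consrV R n).
rewrite fubini_tonelli1//; last first.
  by move=> p; rewrite lee_fin; apply: prodr_ge0 => i _.
rewrite /fubini_F GE /=.
have IHg := IH (fun i => g (lift ord0 i)) (fun i => mg _) (fun i => g0 _).
under eq_integral => t _.
  rewrite ge0_integralZl//; last first.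
  - by rewrite lee_fin.
  - by move=> y _; rewrite lee_fin; apply: prodr_ge0.
  - by apply/measurable_EFinP; exact: (measurable_prod_coord (fun i => mg (lift ord0 i))).
  rewrite IHg; over.
rewrite ge0_integralZr//; last first.
- by apply: prode_ge0 => i _; apply: integral_ge0 => t _; rewrite lee_fin.
- by move=> t _; rewrite lee_fin.
- by apply/measurable_EFinP; exact: mg.
by rewrite big_ord_recl.
Qed.

Section cubes.
Context {R : realType} {n : nat}.
Implicit Types (x y : 'rV[R]_n) (z : 'I_n -> nat).

Definition cube (a h : R) z : set 'rV[R]_n :=
  [set x | forall i, a + h * (z i)%:R <= x ord0 i < a + h * (z i).+1%:R].

Lemma measurable_forall_coord (P : 'I_n -> set R) : (forall i, measurable (P i)) ->
  measurable [set x : 'rV[R]_n | forall i, P i (x ord0 i)].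
Proof.
move=> mP; rewrite (_ : [set _ | _] = \bigcap_(j in [set: 'I_n])
    ((fun x : 'rV[R]_n => x ord0 j) @^-1` P j)).
  apply: fin_bigcap_measurable => // j _; rewrite -[X in measurable X]setTI.
  exact: (measurable_coord j).
by apply/seteqP; split => x /= Ax j => [_|]; exact: Ax.
Qed.

Let cubeE a h z : cube a h z =
  [set x | forall i, `[a + h * (z i)%:R, a + h * (z i).+1%:R[%classic (x ord0 i)].
Proof. by apply/seteqP; split => x /= H i; have := H i; rewrite /= in_itv. Qed.

Lemma measurable_cube a h z : measurable (cube a h z).
Proof.
rewrite cubeE.
exact: (@measurable_forall_coord (fun i => `[a + h * (z i)%:R, a + h * (z i).+1%:R[%classic)).
Qed.

Lemma lebesgue_cube a h z : 0 < h ->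
  lebesgue_rV n (cube a h z) = (h ^+ n)%:E.
Proof.
move=> h0; rewrite cubeE (lebesgue_rV_box (fun i => measurable_itv `[a + h * (z i)%:R, a + h * (z i).+1%:R[)).
rewrite (eq_bigr (fun=> h%:E)) => [|i _]; last first.
  rewrite lebesgue_measure_itv/= lte_fin ltrD2l ltr_pM2l// ltr_nat leqnn.
  by rewrite -EFinB -natr1; congr EFin; ring.
by rewrite prodEFin prodr_const card_ord.
Qed.

Lemma cube_inj a h z z' x : 0 < h -> cube a h z x -> cube a h z' x -> z =1 z'.
Proof.
move=> h0 zx z'x i; have /andP[z1 z2] := zx i; have /andP[z'1 z'2] := z'x i.
have H (p q : nat) : a + h * p%:R <= x ord0 i -> x ord0 i < a + h * q.+1%:R -> (p <= q)%N.
  by move=> H1 /(le_lt_trans H1); rewrite ltrD2l ltr_pM2l// ltr_nat ltnS.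
by apply/eqP; rewrite eqn_leq (H _ _ z1 z'2) (H _ _ z'1 z2).
Qed.

End cubes.

(** * Lower bounds for the maximal function *)

Section M1_lower_bound.
Context {R : realType} {n : nat}.
Implicit Types (x y : 'rV[R]_n).

Lemma enorm_coord x i : `|x ord0 i| <= enorm x.
Proof.
rewrite -sqrtr_sqr ler_wsqrtr// (bigD1 i)//= lerDl.
by apply: sumr_ge0 => j _; exact: sqr_ge0.
Qed.

Lemma enorm_le x : enorm x <= \sum_i `|x ord0 i|.
Proof.
have s0 : 0 <= \sum_i `|x ord0 i| by apply: sumr_ge0.
rewrite -[leRHS]ger0_norm// -sqrtr_sqr ler_wsqrtr//.
rewrite expr2 mulr_suml; apply: ler_sum => i _.
rewrite -(real_normK (num_real (x ord0 i))) expr2.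
rewrite ler_wpM2l// (bigD1 i)//= lerDl.
by apply: sumr_ge0.
Qed.

Lemma measurable_enorm (c : 'rV[R]_n) : measurable_fun setT (fun y => enorm (y - c)).
Proof.
apply: (measurableT_comp (continuous_measurable_fun (@sqrt_continuous R))).
apply: measurable_sum => i; apply: measurable_funX.
under eq_fun do rewrite !mxE.
by apply: measurable_funB => //; exact: measurable_coord.
Qed.

Lemma measurable_eball x r : measurable (eball x r).
Proof.
rewrite (_ : eball x r = (fun y => enorm (y - x)) @^-1` `]-oo, r[%classic).
  by rewrite -[X in measurable X]setTI; exact: measurable_enorm.
by apply/seteqP; split => y; rewrite /= in_itv.
Qed.

Lemma lebesgue_eball_le x r : 0 < r -> (lebesgue_rV n (eball x r) <= ((2 * r) ^+ n)%:E)%E.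
Proof.
move=> r0.
apply: (@le_trans _ _ (lebesgue_rV n [set y | forall i,
    `]x ord0 i - r, x ord0 i + r[%classic (y ord0 i)])).
  apply: le_measure; rewrite ?inE.
  - exact: measurable_eball.
  - exact: (@measurable_forall_coord _ _ (fun i => `]x ord0 i - r, x ord0 i + r[%classic)).
  move=> y yr i /=; rewrite in_itv/= -ltr_distl.
  by apply: le_lt_trans yr; have := enorm_coord (y - x) i; rewrite !mxE.
rewrite (lebesgue_rV_box (fun i => measurable_itv `]x ord0 i - r, x ord0 i + r[)).
rewrite (eq_bigr (fun=> (2 * r)%:E)) => [|i _]; last first.
  rewrite lebesgue_measure_itv/= lte_fin ltrD2l gtrN//.
  by rewrite -EFinB; congr EFin; ring.
by rewrite prodEFin prodr_const card_ord.
Qed.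

(** The ball of radius [r] is a competitor in the supremum, and its volume is at most that of the
    circumscribed cube, [(2 * r) ^+ n]. *)
Lemma measure_le_M1 (mu : {measure set 'rV[R]_n -> \bar R}) x r (S : set 'rV[R]_n) :
  (0 < n)%N -> 0 < r -> measurable S -> S `<=` eball x r ->
  (mu S <= (2 ^+ n * r ^+ n.-1)%:E * M1 mu x)%E.
Proof.
move=> n0 r0 mS Sr.
have c0 : 0 < 2 ^+ n * r ^+ n.-1 by rewrite mulr_gt0 ?exprn_gt0.
apply: (@le_trans _ _ (mu (eball x r))).
  by apply: le_measure; rewrite ?inE//; exact: measurable_eball.
rewrite -lee_pdivrMl//.
apply: (@le_trans _ _ (r%:E * mu (eball x r) / lebesgue_rV n (eball x r))%E); last first.
  by apply: ereal_sup_ubound => /=; exists r.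
have -> : ((2 ^+ n * r ^+ n.-1)^-1)%:E = (r%:E * ((2 * r) ^+ n)^-1%:E)%E.
  rewrite -EFinM; congr EFin.
  rewrite -{2}(prednK n0) exprMn (prednK n0) -[in r ^+ n](prednK n0) exprS.
  by field; rewrite !expf_neq0 ?gt_eqF.
rewrite -!muleA; apply: lee_wpmul2l; first by rewrite lee_fin ltW.
rewrite muleC; apply: lee_wpmul2l => //.
have p0 : 0 < (2 * r) ^+ n by rewrite exprn_gt0// mulr_gt0.
rewrite (_ : (((2 * r) ^+ n)^-1)%:E = (((2 * r) ^+ n)%:E)^-1)%E; last by rewrite inver gt_eqF.
by rewrite lee_pV2 ?inE ?lee_fin ?(ltW p0)//; exact: lebesgue_eball_le.
Qed.

End M1_lower_bound.

Lemma derive_sum_scale {R : realType} {n : nat} (I : Type) (r : seq I) (s : I -> R)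
    (F : I -> 'rV[R]_n -> R) x v : (forall i, C1 (F i)) ->
  'D_v (fun y => \sum_(i <- r) s i * F i y) x = \sum_(i <- r) s i * 'D_v (F i) x.
Proof.
move=> CF; have dF i : derivable (F i) x v by apply: diff_derivable; exact: (CF i).1.
have dS : forall r, derivable (fun y => \sum_(i <- r) s i * F i y) x v.
  move=> r'; apply: diff_derivable.
  suff [] : C1 (fun y => \sum_(i <- r') s i * F i y) by [].
  by apply: C1_sum => i; apply: C1M; [exact: C1_cst|exact: CF].
elim: r => [|i r IH]; first by under eq_fun do rewrite big_nil; rewrite big_nil derive_cst.
under eq_fun do rewrite big_cons.
rewrite big_cons deriveD//; last exact: derivableM.
by rewrite IH deriveMl.
Qed.

(** * Fields whose divergence is a difference of two bumps *)

Section edge_fields.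
Context {R : realType} {n N : nat}.
Variables (a h : R).
Hypothesis h0 : 0 < h.
Local Notation T := {ffun 'I_n -> 'I_N}.
Implicit Types (x : 'rV[R]_n) (i j : 'I_n).

Definition cell_density (z : 'I_n -> nat) x : R := \prod_j sbump a h (z j) (x ord0 j).

(** Unlike [up], this successor does not stop at the last layer: the field of an edge leaving the
    grid is still defined, and its coefficient will be chosen to be 0. *)
Definition nat_up i (z : 'I_n -> nat) : 'I_n -> nat :=
  fun j => if j == i then (z j).+1 else z j.

Let edge_factor i (z : 'I_n -> nat) j (t : R) : R :=
  if j == i then sprim a h (z j) t - sprim a h (z j).+1 t else sbump a h (z j) t.

(** In direction [i] the factor is the difference of the distribution functions of two consecutive
    bumps: it is nonnegative, it vanishes outside their two intervals, and its derivative is the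
    first bump minus the second. The other factors are the bumps common to both cells. *)
Definition edge_potential i (z : 'I_n -> nat) x : R := \prod_j edge_factor i z j (x ord0 j).

Definition corner (z : T) : 'I_n -> nat := fun j => z j.

Definition edge_field (s : 'I_n -> T -> R) x : 'rV[R]_n :=
  \row_i \sum_(z : T) s i z * edge_potential i (corner z) x.

Let edge_factor_deriv i z j : exists2 d : R -> R,
  continuous d & forall t : R, is_derive t 1 (edge_factor i z j) (d t).
Proof.
rewrite /edge_factor; case: eqP => _; last exact: is_derive_sbump.
exists (fun t => sbump a h (z j) t - sbump a h (z j).+1 t).
  by move=> t; apply: cvgB; exact: continuous_sbump.
by move=> t; apply: is_deriveB; exact: is_derive_sprim.
Qed.

Lemma C1_edge_potential i z : C1 (edge_potential i z).
Proof.
apply: C1_prod => j; have [d cd Hd] := edge_factor_deriv i z j.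
exact: C1_coord Hd cd.
Qed.

Lemma derive_edge_potential i z x :
  'D_(delta_mx ord0 i) (edge_potential i z) x =
  cell_density z x - cell_density (nat_up i z) x.
Proof.
have /choice[d Hd] j : exists d : R -> R, continuous d /\
    forall t : R, is_derive t 1 (edge_factor i z j) (d t).
  by have [d ? ?] := edge_factor_deriv i z j; exists d.
rewrite (derive_prod_coord i x (fun j => (Hd j).2) (fun j => (Hd j).1)).
have -> : cell_density z x =
    sbump a h (z i) (x ord0 i) * \prod_(j | j != i) sbump a h (z j) (x ord0 j).
  by rewrite /cell_density (bigD1 i).
have -> : cell_density (nat_up i z) x =
    sbump a h (z i).+1 (x ord0 i) * \prod_(j | j != i) sbump a h (z j) (x ord0 j).
  rewrite /cell_density (bigD1 i)//= /nat_up eqxx; congr (_ * _).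
  by apply: eq_bigr => j ji; rewrite (negbTE ji).
rewrite (eq_bigr (fun j => sbump a h (z j) (x ord0 j))); last first.
  by move=> j ji; rewrite /edge_factor (negbTE ji).
rewrite -mulrBl; congr (_ * _).
have D1 := (Hd i).2 (x ord0 i).
have D2 : is_derive (x ord0 i) 1 (edge_factor i z i)
    (sbump a h (z i) (x ord0 i) - sbump a h (z i).+1 (x ord0 i)).
  by rewrite /edge_factor eqxx; apply: is_deriveB; exact: is_derive_sprim.
by rewrite -(@derive_val _ _ _ _ _ _ _ D1) (@derive_val _ _ _ _ _ _ _ D2).
Qed.

Lemma edge_field_C1 s : continuously_differentiable (edge_field s).
Proof.
apply: (@C1_continuously_differentiable _ _ (fun i x => \sum_(z : T) s i z * edge_potential i (corner z) x)) => i.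
apply: C1_sum => z; apply: C1M; first exact: C1_cst.
exact: C1_edge_potential.
Qed.

Lemma divergence_edge_field s x : divergence (edge_field s) x =
  \sum_i \sum_(z : T) s i z * (cell_density (corner z) x - cell_density (nat_up i (corner z)) x).
Proof.
rewrite /divergence; apply: eq_bigr => i _.
under eq_fun do rewrite mxE.
rewrite (derive_sum_scale _ (s i) x _ (fun z => C1_edge_potential i (corner z))).
by apply: eq_bigr => z _; rewrite derive_edge_potential.
Qed.

Lemma edge_factor_ge0 i z j t : 0 <= edge_factor i z j t.
Proof.
rewrite /edge_factor; case: eqP => _; last exact: sbump_ge0.
rewrite subr_ge0.
have [tz|/ltW tz] := leP t (a + h * (z j).+1%:R).
  by rewrite (sprim_le h0 tz); have /andP[] := sprim_itv01 a h0 (z j) t.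
by rewrite (sprim_ge h0 tz); have /andP[] := sprim_itv01 a h0 (z j).+1 t.
Qed.

Lemma edge_potential_ge0 i z x : 0 <= edge_potential i z x.
Proof. by apply: prodr_ge0 => j _; exact: edge_factor_ge0. Qed.

Lemma edge_potential_neq0 i z x : edge_potential i z x != 0 ->
  forall j, a + h * (z j)%:R <= x ord0 j <= a + h * (nat_up i z j).+1%:R.
Proof.
rewrite prodf_seq_neq0 => /allP H j; have := H j (mem_index_enum _).
rewrite /edge_factor /nat_up; case: (j =P i) => _ /= H1; rewrite !leNgt -negb_or; apply: contra H1.
  case/orP => /ltW H1; first by rewrite !sprim_le ?subr0//; rewrite (le_trans H1)// lerD2l ler_pM2l// ler_nat.
  by rewrite !sprim_ge ?subrr//; apply: le_trans H1; rewrite lerD2l ler_pM2l// ler_nat.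
by case/orP => /ltW H1; rewrite sbump_out// H1 ?orbT.
Qed.

Let sum_sbump_le (t : R) : 0 <= \sum_(s < N) sbump a h s t <= 2 / h.
Proof.
have sge (s : nat) : 0 <= sbump a h s t by exact: sbump_ge0.
apply/andP; split; first by apply: sumr_ge0.
have sup (p : nat) : sbump a h p t != 0 -> a + h * p%:R < t < a + h * p.+1%:R.
  move=> H; rewrite !ltNge -negb_or; apply: contra H => H.
  by rewrite sbump_out// orbC.
have [/existsP[s0 s0t]|/existsPn H] := boolP [exists s : 'I_N, sbump a h s t != 0]; last first.
  rewrite big1 ?divr_ge0 ?ltW// => s _; apply/eqP; have := H s; by rewrite negbK.
rewrite (bigD1 s0)//= big1 ?addr0; first exact: sbump_le.
move=> s ss0; apply: contraNeq ss0 => /sup/andP[H1 H2].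
have /andP[H3 H4] := sup _ s0t.
apply/eqP/val_inj/eqP; rewrite /= eqn_leq; apply/andP; split.
  by have := lt_trans H1 H4; rewrite ltrD2l ltr_pM2l// ltr_nat ltnS.
by have := lt_trans H3 H2; rewrite ltrD2l ltr_pM2l// ltr_nat ltnS.
Qed.

(** The sum over [z] factorizes into sums over single coordinates. In direction [i] it telescopes to
    a difference of two values in [0, 1]; in each of the other n - 1 directions at most one bump is
    nonzero at a given point. So the bound does not depend on the number of cells. *)
Lemma sum_edge_potential_le i x :
  \sum_(z : T) edge_potential i (corner z) x <= (2 / h) ^+ n.-1.
Proof.
pose f j (s : 'I_N) := if j == i then sprim a h s (x ord0 j) - sprim a h s.+1 (x ord0 j)
  else sbump a h s (x ord0 j).
rewrite (eq_bigr (fun z : T => \prod_j f j (z j)))//.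
rewrite -(bigA_distr_bigA f) (bigD1 i)//= {1}/f eqxx.
have S1 : 0 <= \sum_(s < N) (sprim a h s (x ord0 i) - sprim a h s.+1 (x ord0 i)) <= 1.
  apply/andP; split.
    apply: sumr_ge0 => s _.
    by have := edge_factor_ge0 i (fun=> s) i (x ord0 i); rewrite /edge_factor eqxx.
  under eq_bigr do rewrite -opprB.
  rewrite sumrN -(big_mkord xpredT (fun s => sprim a h s.+1 (x ord0 i) - sprim a h s (x ord0 i))).
  rewrite (telescope_sumr (fun s => sprim a h s (x ord0 i)))// opprB.
  have /andP[_ H1] := sprim_itv01 a h0 0 (x ord0 i).
  have /andP[H2 _] := sprim_itv01 a h0 N (x ord0 i); lra.
apply: (@le_trans _ _ (1 * \prod_(j | j != i) (2 / h))).
  case/andP: S1 => S1 S1'; apply: ler_pM => //.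
    by apply: prodr_ge0 => j ji; rewrite /f (negbTE ji); case/andP: (sum_sbump_le (x ord0 j)).
  by apply: ler_prod => j ji; rewrite /f (negbTE ji).
rewrite mul1r prodr_const le_eqVlt; apply/orP; left; apply/eqP; congr (_ ^+ _).
by have := cardC1 i; rewrite card_ord => <-; apply: eq_card => j; rewrite !inE.
Qed.

End edge_fields.

Section variation_lower_bound.
Context {R : realType} {n N : nat}.
Variables (a h : R).
Hypothesis h0 : 0 < h.
Local Notation T := {ffun 'I_n -> 'I_N}.
Implicit Types (x : 'rV[R]_n) (i j : 'I_n) (s : 'I_n -> T -> R) (u : 'rV[R]_n -> R).

Lemma edge_field_compact s : compactly_supported (edge_field a h s).
Proof.
pose M := `|a| + h * N.+1%:R.
have Mc : compact [set x : 'rV[R]_n | forall j, `[- M, M]%classic (x ord0 j)].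
  by apply: (@rV_compact _ _ (fun=> `[- M, M]%classic)) => j; exact: segment_compact.
have Mcl : closed [set x : 'rV[R]_n | forall j, `[- M, M]%classic (x ord0 j)].
  by apply: compact_closed => //; exact: norm_hausdorff.
apply: (subclosed_compact _ Mc); first exact: closed_closure.
rewrite [X in _ `<=` X](closure_id _).1//; apply: closureS => x /= sx j.
have [/existsP[i /existsP[z zx]]|/existsPn H] :=
    boolP [exists i, exists z : T, edge_potential a h i (corner z) x != 0]; last first.
  exfalso; move/negP: sx; apply; apply/eqP/rowP => i; rewrite !mxE big1// => z _.
  by have /existsPn/(_ z) := H i; rewrite negbK => /eqP ->; rewrite mulr0.
have /andP[H1 H2] := edge_potential_neq0 h0 zx j.
have [a1 a2] : - `|a| <= a /\ a <= `|a| by rewrite lerNl ler_norm -normrN ler_norm.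
have hN : 0 <= h * N.+1%:R by rewrite mulr_ge0 ?(ltW h0).
rewrite in_itv/=; apply/andP; split.
  apply: le_trans H1; rewrite /M opprD lerD//.
  by rewrite (@le_trans _ _ 0) ?oppr_le0// mulr_ge0 ?(ltW h0).
apply: (le_trans H2); rewrite /M lerD// ler_pM2l// ler_nat ltnS /nat_up /corner.
by case: eqP => _; rewrite ?(ltn_ord (z j))// ltnW.
Qed.

(** The factor [n] comes from bounding the Euclidean norm by the sum of the coordinates. Edges whose
    potential vanishes at [x] do not count, so [B] may be chosen depending on [x]; this is where a
    non-constant weight can be accommodated. *)
Lemma enorm_edge_field_le s x (B : R) : 0 <= B ->
  (forall i z, edge_potential a h i (corner z) x != 0 -> `|s i z| <= B) ->
  enorm (edge_field a h s x) <= n%:R * (B * (2 / h) ^+ n.-1).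
Proof.
move=> B0 HB; apply: (le_trans (enorm_le _)).
apply: (@le_trans _ _ (\sum_(i < n) B * (2 / h) ^+ n.-1)); last first.
  by rewrite sumr_const card_ord [n%:R * _]mulr_natl.
apply: ler_sum => i _; rewrite mxE; apply: (le_trans (ler_norm_sum _ _ _)).
apply: (@le_trans _ _ (B * \sum_(z : T) edge_potential a h i (corner z) x)); last first.
  by apply: ler_wpM2l => //; exact: sum_edge_potential_le.
rewrite mulr_sumr; apply: ler_sum => z _; rewrite normrM.
have p0 := edge_potential_ge0 a h0 i (corner z) x.
have [->|pn0] := eqVneq (edge_potential a h i (corner z) x) 0.
  by rewrite normr0 !mulr0.
by rewrite (ger0_norm p0); apply: ler_wpM2r => //; exact: HB.
Qed.

Definition cell_avg u (z : 'I_n -> nat) : R :=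
  fine (\int[lebesgue_rV n]_x (u x * cell_density a h z x)%:E).

Lemma variation_ge_edge_sum (w : 'rV[R]_n -> \bar R) u s :
  (forall z, (lebesgue_rV n).-integrable setT (fun x => (u x * cell_density a h z x)%:E)) ->
  (forall x, (enorm (edge_field a h s x))%:E <= w x)%E ->
  ((\sum_i \sum_(z : T) s i z * (cell_avg u (corner z) - cell_avg u (nat_up i (corner z))))%:E
    <= variation_weight w u)%E.
Proof.
move=> iu sw; apply: ereal_sup_ubound => /=.
exists (edge_field a h s).
  by split => //; [exact: edge_field_C1|exact: edge_field_compact].
under eq_integral do rewrite divergence_edge_field// mulr_sumr -sumEFin.
have iuE z : ((cell_avg u z)%:E = \int[lebesgue_rV n]_x (u x * cell_density a h z x)%:E)%E.
  by rewrite fineK//; exact: integrable_fin_num.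
have iB i (z : T) : (lebesgue_rV n).-integrable setT (fun x =>
    (u x * cell_density a h (corner z) x)%:E - (u x * cell_density a h (nat_up i (corner z)) x)%:E)%E.
  by apply: integrableB => //; exact: iu.
have E i x : (u x * (\sum_(z : T) s i z * (cell_density a h (corner z) x - cell_density a h (nat_up i (corner z)) x)))%:E =
  (\sum_(z : T) (s i z)%:E * ((u x * cell_density a h (corner z) x)%:E - (u x * cell_density a h (nat_up i (corner z)) x)%:E))%E.
  rewrite mulr_sumr -sumEFin; apply: eq_bigr => z _.
  by rewrite -EFinB -EFinM; congr EFin; ring.
under eq_integral do under eq_bigr do rewrite E.
rewrite integral_sum//; last first.
  by move=> i; apply: integrable_sum => // z _; exact: integrableZl.
rewrite -sumEFin; apply: eq_bigr => i _.
rewrite integral_sum//; last by move=> z; exact: integrableZl.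
rewrite -sumEFin; apply: eq_bigr => z _.
rewrite integralZl// integralB//; [|exact: iu..].
by rewrite -!iuE -EFinB -EFinM.
Qed.

End variation_lower_bound.

(** * Convergence of the averages *)

Section integral_abs.
Context d (T : measurableType d) (R : realType).
Variables (mu : {measure set T -> \bar R}) (D : set T).
Hypothesis mD : measurable D.

Lemma integral_abs_triangle (f p q : T -> R) :
  measurable_fun D f -> measurable_fun D p -> measurable_fun D q ->
  (forall x, D x -> `|f x| <= `|p x| + `|q x|) ->
  (\int[mu]_(x in D) (`|f x|)%:E <=
   \int[mu]_(x in D) (`|p x|)%:E + \int[mu]_(x in D) (`|q x|)%:E)%E.
Proof.
move=> mf mp mq H.
have mn (g : T -> R) : measurable_fun D g -> measurable_fun D (fun x => (`|g x|)%:E : \bar R).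
  by move=> mg; apply/measurable_EFinP; exact: measurableT_comp.
rewrite -ge0_integralD//; try exact: mn.
apply: ge0_le_integral => //; first exact: mn.
by apply: emeasurable_funD; exact: mn.
Qed.

End integral_abs.

Lemma exists_half_expn_lt (R : realType) (e : R) : 0 < e -> exists k, 2^-1 ^+ k < e.
Proof.
move=> e0; exists (Num.truncn e^-1).+1.
rewrite exprVn invf_plt ?posrE ?exprn_gt0//; apply: (lt_trans (truncnS_gt _)).
by rewrite -natrX ltr_nat ltn_expl.
Qed.

(** * Density in L^1 of the functions constant on dyadic cubes *)

Section saturated.
Context {R : realType} {n : nat}.
Variables (a : R) (B : set 'rV[R]_n).
Hypothesis mB : measurable B.
Hypothesis Bfin : (lebesgue_rV n B < +oo)%E.
Local Notation L := (lebesgue_rV n).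

(** [V] is [Prop] for sets and [R] for functions. The indices being natural numbers, only the
    orthant with corner [a] is concerned. *)
Definition constant_on_cubes (k : nat) {V : Type} (f : 'rV[R]_n -> V) :=
  forall (z : 'I_n -> nat) x y, cube a (2^-1 ^+ k) z x -> cube a (2^-1 ^+ k) z y -> f x = f y.

Lemma constant_on_cubesW (V : Type) (f : 'rV[R]_n -> V) k k' : (k <= k')%N ->
  constant_on_cubes k f -> constant_on_cubes k' f.
Proof.
move=> kk' Hf z x y.
have sub : cube a (2^-1 ^+ k' : R) z `<=` cube a (2^-1 ^+ k) (fun i => z i %/ 2 ^ (k' - k))%N.
  move=> t zt i; have /andP[H1 H2] := zt i.
  have E : 2^-1 ^+ k = 2^-1 ^+ k' * (2 ^ (k' - k))%:R :> R.
    by rewrite -{1}(subnK kk') exprD natrX mulrAC -exprMn mulVf// expr1n mul1r.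
  have p0 : 0 < 2^-1 ^+ k' :> R by rewrite exprn_gt0.
  rewrite E -!mulrA -!natrM; apply/andP; split.
    by apply: le_trans H1; rewrite lerD2l ler_pM2l// ler_nat mulnC leq_trunc_div.
  apply: (lt_le_trans H2); rewrite lerD2l ler_pM2l// ler_nat mulnC.
  by rewrite ltn_ceil// expn_gt0.
by move=> /sub zx /sub zy; exact: Hf zx zy.
Qed.

Let LU_half (X Y : set 'rV[R]_n) (e : R) : measurable X -> measurable Y ->
  (L X <= (e / 2)%:E -> L Y <= (e / 2)%:E -> L (X `|` Y) <= e%:E)%E.
Proof.
move=> mX mY Xe Ye; apply: le_trans (measureU2 _ mX mY) _.
by rewrite (splitr e) EFinD leeD.
Qed.

(** The sets that unions of cubes approximate are collected in a class in order to show that it is a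
    sigma-algebra containing the open sets, hence contains every Borel set. *)
Definition almost_saturated (A : set 'rV[R]_n) := measurable A /\
  forall e : R, 0 < e -> exists k (D : set 'rV[R]_n), [/\ measurable D, constant_on_cubes k D &
    (L (B `&` (A `\` D `|` D `\` A)) <= e%:E)%E].

Let mdiff (A D : set 'rV[R]_n) : measurable A -> measurable D ->
  measurable (B `&` (A `\` D `|` D `\` A)).
Proof. by move=> mA mD; apply: measurableI => //; apply: measurableU; exact: measurableD. Qed.

Lemma almost_saturated_id k D : measurable D -> constant_on_cubes k D -> almost_saturated D.
Proof.
move=> mD sD; split=> // e e0; exists k, D; split=> //.
by rewrite setDv setU0 setI0 measure0 lee_fin ltW.
Qed.

Lemma almost_saturatedC A : almost_saturated A -> almost_saturated (~` A).
Proof.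
move=> [mA HA]; split; first exact: measurableC.
move=> e /HA[k [D [mD sD AD]]]; exists k, (~` D); split.
- exact: measurableC.
- by move=> z x y zx zy; rewrite /setC/= (sD z x y).
- by rewrite !setDE !setCK setUC [~` D `&` A]setIC [~` A `&` D]setIC -!setDE.
Qed.

Lemma almost_saturatedU A A' : almost_saturated A -> almost_saturated A' ->
  almost_saturated (A `|` A').
Proof.
move=> [mA HA] [mA' HA']; split; first exact: measurableU.
move=> e e0; have e20 : 0 < e / 2 by rewrite divr_gt0.
have [k [D [mD sD AD]]] := HA _ e20; have [k' [D' [mD' sD' AD']]] := HA' _ e20.
exists (maxn k k'), (D `|` D'); split; first exact: measurableU.
  move=> z x y zx zy.
  have := constant_on_cubesW (leq_maxl k k') sD zx zy.
  have := constant_on_cubesW (leq_maxr k k') sD' zx zy.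
  by rewrite /setU/= => -> ->.
apply: (@le_trans _ _ (L ((B `&` (A `\` D `|` D `\` A)) `|` (B `&` (A' `\` D' `|` D' `\` A'))))).
  apply: le_measure; rewrite ?inE.
  - by apply: mdiff; exact: measurableU.
  - by apply: measurableU; exact: mdiff.
  - move=> x [Bx [[[Ax|Ax]/not_orP[Dx Dx']]|[[Ax|Ax]/not_orP[Dx Dx']]]].
    + by left; split => //; left.
    + by right; split => //; left.
    + by left; split => //; right.
    + by right; split => //; right.
by apply: LU_half => //; exact: mdiff.
Qed.

(** Because [B] has finite measure, continuity from above makes the part of the union missed by
    finitely many sets smaller than [e / 2] in [B]; the finite union is approximated up to the other
    half. *)
Lemma almost_saturated_bigcup (A : (set 'rV[R]_n)^nat) :
  (forall i, almost_saturated (A i)) -> almost_saturated (\bigcup_i A i).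
Proof.
move=> HA; have mA i : measurable (A i) by case: (HA i).
have mU : measurable (\bigcup_i A i) by exact: bigcup_measurable.
split=> // e e0; have e20 : 0 < e / 2 by rewrite divr_gt0.
have HU m : almost_saturated (\big[setU/set0]_(i < m) A i).
  elim: m => [|m IH]; last by rewrite big_ord_recr; exact: almost_saturatedU.
  by rewrite big_ord0; apply: (@almost_saturated_id 0%N) => //.
pose F m := B `&` ((\bigcup_i A i) `\` \big[setU/set0]_(i < m) A i).
have mF m : measurable (F m).
  by apply: measurableI => //; apply: measurableD => //; case: (HU m).
have Foo m : (L (F m) < +oo)%E.
  by apply: le_lt_trans Bfin; apply: le_measure; rewrite ?inE//; exact: subIsetl.
have ndF : nonincreasing_seq F.
  move=> p q pq; apply/subsetPset => x [Bx [Ux nx]]; split=> //; split=> //.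
  by apply: contra_not nx; exact: subset_bigsetU.
have F0 : \bigcap_m F m = set0.
  rewrite -subset0 => x Fx.
  have [Bx [[i _ Aix] _]] := Fx 0%N I.
  have [_ [_]] := Fx i.+1 I; apply.
  by rewrite big_ord_recr; right.
have := nonincreasing_cvg_mu (Foo 0%N) mF _ ndF.
rewrite F0 measure0 => /(_ measurable0) cF.
have [m Fm] : exists m, (L (F m) <= (e / 2)%:E)%E.
  have /fine_cvgP[_ /cvgrPdist_le/(_ _ e20)[m _ Hm]] := cF.
  exists m; have := Hm m (leqnn m); rewrite sub0r normrN => H.
  have fm : L (F m) \is a fin_num by rewrite (ge0_fin_numE (measure_ge0 L (F m))) Foo.
  by rewrite -(fineK fm) lee_fin; exact: le_trans (ler_norm _) H.
have [_ /(_ _ e20)[k [D [mD sD AD]]]] := HU m.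
have mUm : measurable (\big[setU/set0]_(i < m) A i) by case: (HU m).
exists k, D; split=> //.
apply: (@le_trans _ _ (L (F m `|` (B `&` (\big[setU/set0]_(i < m) A i `\` D `|` D `\` \big[setU/set0]_(i < m) A i))))).
  apply: le_measure; rewrite ?inE.
  - exact: mdiff.
  - by apply: measurableU => //; exact: mdiff.
  - move=> x [Bx [[Ux Dx]|[Dx Ux]]].
      have [Umx|nUm] := pselect ((\big[setU/set0]_(i < m) A i) x).
        by right; split => //; left.
      by left.
    right; split=> //; right; split=> //; apply: contra_not Ux.
    by rewrite -bigcup_mkord => -[i _ Aix]; exists i.
by apply: LU_half => //; exact: mdiff.
Qed.

Let pow2_gt0 k : 0 < 2^-1 ^+ k :> R.
Proof. by rewrite exprn_gt0. Qed.

(** The half-space is exhausted by those bounded by the last hyperplane of the grid of mesh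
    [2^-1 ^+ k] at or below [b]; they cut no cube of generation [k]. *)
Lemma almost_saturated_ltr i (b : R) : almost_saturated [set x | x ord0 i < b].
Proof.
pose D k := [set x : 'rV[R]_n | x ord0 i < a + 2^-1 ^+ k * (Num.floor (2 ^+ k * (b - a)))%:~R].
have mD k : measurable (D k).
  rewrite (_ : D k = (fun x : 'rV[R]_n => x ord0 i) @^-1` `]-oo, a + 2^-1 ^+ k * (Num.floor (2 ^+ k * (b - a)))%:~R[%classic).
    by rewrite -[X in measurable X]setTI; exact: (measurable_coord i).
  by apply/seteqP; split => x; rewrite /= in_itv.
have sD k : constant_on_cubes k (D k).
  suff H z x y : cube a (2^-1 ^+ k) z x -> cube a (2^-1 ^+ k) z y -> D k x -> D k y.
    by move=> z x y zx zy; apply/propext; split; exact: H.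
  rewrite /D /= => zx zy Dx; have /andP[H1 _] := zx i; have /andP[_ H2] := zy i.
  apply: (lt_le_trans H2); rewrite lerD2l ler_pM2l//.
  have := le_lt_trans H1 Dx; rewrite ltrD2l ltr_pM2l//.
  by rewrite !pmulrn ltr_int ler_int => zF; lia.
rewrite [X in almost_saturated X](_ : _ = \bigcup_k D k).
  by apply: almost_saturated_bigcup => k; exact: almost_saturated_id (mD k) (sD k).
have E k : 2^-1 ^+ k * (2 ^+ k * (b - a)) = b - a :> R.
  by rewrite mulrA -exprMn mulVf// expr1n mul1r.
apply/seteqP; split => [x /= xb|x [k _]]; last first.
  rewrite /D /= => /lt_le_trans; apply; rewrite -lerBrDl -[leRHS](E k) ler_pM2l//.
  exact: floor_le.
have [k ke] := @exists_half_expn_lt R (b - x ord0 i) (ltac:(by rewrite subr_gt0)).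
exists k => //; rewrite /D /=.
have /andP[_] := floor_itv (2 ^+ k * (b - a)).
rewrite -(ltr_pM2l (pow2_gt0 k)) E intrD mulrDr mulr1; lra.
Qed.

Lemma almost_saturated_measurable A : measurable A -> almost_saturated A.
Proof.
have ST : almost_saturated setT.
  by apply: (@almost_saturated_id 0%N).
have Sgt i (b : R) : almost_saturated [set x | b < x ord0 i].
  rewrite [X in almost_saturated X](_ : _ = \bigcup_m ~` [set x : 'rV[R]_n | x ord0 i < b + 2^-1 ^+ m]).
    by apply: almost_saturated_bigcup => m; apply/almost_saturatedC/almost_saturated_ltr.
  apply/seteqP; split => [x /= bx|x [m _]] /=.
    have [m mx] := @exists_half_expn_lt R (x ord0 i - b) (ltac:(by rewrite subr_gt0)).
    by exists m => //=; apply/negP; rewrite -leNgt; lra.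
  by move/negP; rewrite -leNgt; apply: lt_le_trans; rewrite ltrDl.
have SI A1 A2 : almost_saturated A1 -> almost_saturated A2 -> almost_saturated (A1 `&` A2).
  move=> S1 S2; rewrite -[_ `&` _]setCK setCI; apply: almost_saturatedC.
  by apply: almost_saturatedU; exact: almost_saturatedC.
have Scap (F : (set 'rV[R]_n)^nat) : (forall i, almost_saturated (F i)) -> almost_saturated (\bigcap_i F i).
  move=> SF; rewrite -[\bigcap_i _]setCK setC_bigcap; apply: almost_saturatedC.
  by apply: almost_saturated_bigcup => i; exact: almost_saturatedC.
have Sball (q : 'rV[R]_n) (r : R) : almost_saturated (ball q r).
  have [r0|r0] := ltP 0 r; last first.
    rewrite (_ : ball _ _ = set0); first by rewrite -setCT; exact: almost_saturatedC.
    by rewrite -subset0 => x /= []; rewrite ltNge r0.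
  (* The intersection over the coordinates is written over all natural numbers, indices from [n] on
     giving the full space, so that closure under countable intersections applies. *)
  rewrite (_ : ball q r = \bigcap_m [set x : 'rV[R]_n | forall i : 'I_n, i = m :> nat ->
      q ord0 i - r < x ord0 i /\ x ord0 i < q ord0 i + r]); last first.
    apply/seteqP; split => [x [_ qx] m _ i _|x H].
      by have := qx ord0 i; rewrite /ball/= ltr_distlC => /andP[].
    split => // i j; rewrite (ord1 i) /ball/= ltr_distlC.
    by have [-> ->] := H j I j erefl.
  apply: Scap => m; have [mn|mn] := ltnP m n.
    rewrite [X in almost_saturated X](_ : _ = [set x : 'rV[R]_n | q ord0 (Ordinal mn) - r < x ord0 (Ordinal mn)] `&`
        [set x : 'rV[R]_n | x ord0 (Ordinal mn) < q ord0 (Ordinal mn) + r]).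
      by apply: SI; [exact: Sgt|exact: almost_saturated_ltr].
    apply/seteqP; split => x /= H; first by apply: H.
    by move=> i im; rewrite (_ : i = Ordinal mn)//; exact: val_inj.
  rewrite [X in almost_saturated X](_ : _ = setT)//; apply/seteqP; split => // x _ i im.
  by have := ltn_ord i; rewrite im ltnNge mn.
have Scount (I : countType) (P : set I) (F : I -> set 'rV[R]_n) :
    (forall i, almost_saturated (F i)) -> almost_saturated (\bigcup_(i in P) F i).
  move=> SF; rewrite (_ : \bigcup_(i in P) F i = \bigcup_m
     (if (unpickle m : option I) is Some i then if `[< P i >] then F i else set0 else set0)).
    apply: almost_saturated_bigcup => m; case: unpickle => [i|]; last first.
      by rewrite -setCT; exact: almost_saturatedC.
    by case: ifP => // _; rewrite -setCT; exact: almost_saturatedC.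
  apply/seteqP; split => [x [i Pi Fx]|x [m _]].
    by exists (pickle i) => //; rewrite pickleK asboolT.
  by case: unpickle => // i; case: asboolP => // Pi Fi; exists i.
have Sopen U : open U -> almost_saturated U.
  by move=> oU; rewrite (open_rV_bigcup_rat oU); apply: Scount => q; exact: Sball.
have Ssig : sigma_algebra setT almost_saturated.
  split.
  - by rewrite -setCT; exact: almost_saturatedC.
  - by move=> X SX; rewrite setTD; exact: almost_saturatedC.
  - by move=> F SF; exact: almost_saturated_bigcup.
by apply: smallest_sub => //; exact: Sopen.
Qed.

Definition cube_approximable (v : 'rV[R]_n -> R) := forall e : R, 0 < e ->
  exists k (g : 'rV[R]_n -> R), [/\ measurable_fun setT g, constant_on_cubes k g &
    (\int[L]_(x in B) (`|v x - g x|)%:E <= e%:E)%E].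

Lemma cube_approximable_indic A : measurable A -> cube_approximable \1_A.
Proof.
move=> mA e e0; have [_ /(_ e e0)[k [D [mD sD AD]]]] := almost_saturated_measurable mA.
exists k, \1_D; split.
- exact: measurable_indic.
- move=> z x y zx zy; rewrite !indicE; congr (nat_of_bool _)%:R.
  by apply/idP/idP; rewrite !inE (sD z x y).
apply: le_trans AD.
rewrite (eq_integral (fun x => (\1_(A `\` D `|` D `\` A) x)%:E)); last first.
  move=> x _; congr EFin; rewrite !indicE in_setU !in_setD.
  by case: (x \in A); case: (x \in D); rewrite /= ?subrr ?subr0 ?sub0r ?normrN ?normr0 ?normr1.
rewrite integral_indic//; first by rewrite setIC.
by apply: measurableU; exact: measurableD.
Qed.

Lemma cube_approximable_close (v v' : 'rV[R]_n -> R) (e : R) : measurable_fun setT v -> measurable_fun setT v' ->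
  cube_approximable v' -> 0 < e ->
  (\int[L]_(x in B) (`|v x - v' x|)%:E <= (e / 2)%:E)%E ->
  exists k (g : 'rV[R]_n -> R), [/\ measurable_fun setT g, constant_on_cubes k g &
    (\int[L]_(x in B) (`|v x - g x|)%:E <= e%:E)%E].
Proof.
move=> mv mv' Av' e0 vv'; have [|k [g [mg sg v'g]]] := Av' (e / 2); first by rewrite divr_gt0.
exists k, g; split=> //.
apply: (le_trans (@integral_abs_triangle _ _ _ L B mB (fun x => v x - g x)
  (fun x => v x - v' x) (fun x => v' x - g x) _ _ _ _)).
- by apply: measurable_funTS; exact: measurable_funB.
- by apply: measurable_funTS; exact: measurable_funB.
- by apply: measurable_funTS; exact: measurable_funB.
- by move=> x _; exact: ler_distD.
by rewrite (splitr e) EFinD leeD.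
Qed.

Lemma cube_approximableD (v v' : 'rV[R]_n -> R) : measurable_fun setT v -> measurable_fun setT v' ->
  cube_approximable v -> cube_approximable v' -> cube_approximable (fun x => v x + v' x).
Proof.
move=> mv mv' Av Av' e e0.
have e20 : 0 < e / 2 by rewrite divr_gt0.
have [k [g [mg sg vg]]] := Av _ e20; have [k' [g' [mg' sg' vg']]] := Av' _ e20.
exists (maxn k k'), (fun x => g x + g' x); split.
- exact: measurable_funD.
- move=> z x y zx zy; congr (_ + _).
    exact: constant_on_cubesW (leq_maxl k k') sg _ _ _ zx zy.
  exact: constant_on_cubesW (leq_maxr k k') sg' _ _ _ zx zy.
apply: (le_trans (@integral_abs_triangle _ _ _ L B mB (fun x => v x + v' x - (g x + g' x))
  (fun x => v x - g x) (fun x => v' x - g' x) _ _ _ _)).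
- by apply: measurable_funTS; apply: measurable_funB; exact: measurable_funD.
- by apply: measurable_funTS; exact: measurable_funB.
- by apply: measurable_funTS; exact: measurable_funB.
- by move=> x _; rewrite opprD addrACA ler_normD.
by rewrite (splitr e) EFinD leeD.
Qed.

Lemma cube_approximableZ (c : R) (v : 'rV[R]_n -> R) : measurable_fun setT v ->
  cube_approximable v -> cube_approximable (fun x => c * v x).
Proof.
move=> mv Av e e0.
have c0 : 0 < `|c| + 1 by rewrite ltr_wpDl.
have [|k [g [mg sg vg]]] := Av (e / (`|c| + 1)); first by rewrite divr_gt0.
exists k, (fun x => c * g x); split.
- exact: measurable_funM.
- by move=> z x y zx zy; rewrite (sg z x y).
under eq_integral do rewrite -mulrBr normrM EFinM.
have mvg : measurable_fun B (fun x => (`|v x - g x|)%:E).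
  by apply: measurable_funTS; apply/measurable_EFinP; apply: measurableT_comp => //; exact: measurable_funB.
rewrite ge0_integralZl//.
apply: (@le_trans _ _ (`|c|%:E * (e / (`|c| + 1))%:E)%E); first by rewrite lee_wpmul2l.
rewrite -EFinM lee_fin mulrA ler_pdivrMr// mulrC ler_wpM2l ?ltW//.
by rewrite ltrDl.
Qed.

Lemma cube_approximable_sum (I : Type) (r : seq I) (F : I -> 'rV[R]_n -> R) :
  (forall i, measurable_fun setT (F i)) -> (forall i, cube_approximable (F i)) ->
  cube_approximable (fun x => \sum_(i <- r) F i x).
Proof.
move=> mF AF; elim: r => [|i r IH].
  move=> e e0; exists 0%N, (fun=> 0); split=> //.
  under eq_integral do rewrite big_nil subr0 normr0.
  by rewrite integral0 lee_fin ltW.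
rewrite (_ : (fun x => _) = (fun x => F i x + \sum_(j <- r) F j x)).
  by apply: cube_approximableD => //; exact: measurable_sum.
by apply/funext => x; rewrite big_cons.
Qed.

Import HBSimple.

(** Simple functions are dense in L^1(B), and by linearity they inherit approximability from
    indicators. *)
Lemma cube_approximable_integrable (v : 'rV[R]_n -> R) : measurable_fun setT v ->
  (\int[L]_(x in B) (`|v x|)%:E < +oo)%E -> cube_approximable v.
Proof.
move=> mv voo e e0.
have iv : L.-integrable B (EFin \o v).
  by apply/integrableP; split; [apply/measurable_EFinP; exact: measurable_funTS|].
have [s [is_ _ cs]] := approximation_sfun_integrable mB iv.
have [m sm] : exists m, (\int[L]_(z in B) `|(v z)%:E - (s m z)%:E| <= (e / 2)%:E)%E.
  have e20 : 0 < e / 2 by rewrite divr_gt0.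
  have /fine_cvgP[[m1 _ fm] /cvgrPdist_le/(_ _ e20)[m _ Hm]] := cs.
  exists (maxn m1 m); have := Hm (maxn m1 m) (leq_maxr _ _).
  rewrite sub0r normrN => H.
  have F := fm (maxn m1 m) (leq_maxl _ _).
  by rewrite -(fineK F) lee_fin; exact: le_trans (ler_norm _) H.
apply: (@cube_approximable_close v (s m)) => //.
rewrite (funext (fimfunEord (s m))).
apply: cube_approximable_sum => i.
  by apply: measurable_funM => //; exact: measurable_indic.
apply: cube_approximableZ; first exact: measurable_indic.
exact: cube_approximable_indic.
Qed.

End saturated.

(** * Averages against the bumps *)

Section cell_averages.
Context {R : realType} {n : nat}.
Variables (a h : R).
Hypothesis h0 : 0 < h.
Local Notation L := (lebesgue_rV n).
Implicit Types (z : 'I_n -> nat) (x : 'rV[R]_n) (u f : 'rV[R]_n -> R).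

Lemma measurable_cell_density z : measurable_fun setT (@cell_density R n a h z).
Proof.
apply: (@measurable_prod_coord R n (fun j => sbump a h (z j))) => i.
by apply: continuous_measurable_fun; exact: continuous_sbump.
Qed.

Lemma cell_density_ge0 z x : 0 <= cell_density a h z x.
Proof. by apply: prodr_ge0 => j _; exact: sbump_ge0. Qed.

Lemma cell_density_out z x : ~ cube a h z x -> cell_density a h z x = 0.
Proof.
move=> nzx; apply/eqP; rewrite prodf_seq_eq0; apply/hasP.
have /existsNP[i Hi] := nzx.
exists i; first exact: mem_index_enum.
apply/eqP/sbump_out => //; move/negP: Hi; rewrite negb_and -!leNgt -!ltNge.
by case/orP => [/ltW|] ->; rewrite ?orbT.
Qed.

Lemma cell_density_le z x : cell_density a h z x <= (2 / h) ^+ n * \1_(cube a h z) x.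
Proof.
have [zx|zx] := pselect (cube a h z x); last first.
  by rewrite cell_density_out// indicE memNset// mulr0.
rewrite indicE mem_set// mulr1 -[n in leRHS]card_ord -prodr_const.
by apply: ler_prod => j _; rewrite sbump_ge0 ?sbump_le.
Qed.

Lemma integral_cell_density z : (\int[L]_x (cell_density a h z x)%:E = 1)%E.
Proof.
rewrite (@integral_prod_coord R n (fun j => sbump a h (z j))).
- by rewrite big1// => j _; exact: integral_sbump.
- by move=> i; apply: continuous_measurable_fun; exact: continuous_sbump.
- by move=> i t; exact: sbump_ge0.
Qed.

Lemma integral_mul_cell_density_le u z : measurable_fun setT u ->
  (\int[L]_x (`|u x * cell_density a h z x|)%:E <=
   ((2 / h) ^+ n)%:E * \int[L]_(x in cube a h z) (`|u x|)%:E)%E.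
Proof.
move=> mu.
have mau : measurable_fun setT (fun x => `|u x|) by exact: measurableT_comp.
rewrite -ge0_integralZl//; first last.
- by rewrite lee_fin exprn_ge0// divr_ge0// ltW.
- by apply: measurable_funTS; exact/measurable_EFinP.
- exact: measurable_cube.
rewrite [leRHS]integral_mkcond; apply: ge0_le_integral => //.
- apply/measurable_EFinP; apply: measurableT_comp => //.
  by apply: measurable_funM => //; exact: measurable_cell_density.
- apply/(measurable_restrictT _ (measurable_cube a h z)).
  by apply: measurable_funeM; apply: measurable_funTS; exact/measurable_EFinP.
move=> x _; rewrite patchE normrM (ger0_norm (cell_density_ge0 _ _)).
case: ifPn => [/set_mem zx|/negP zx].
  rewrite -EFinM lee_fin mulrC ler_wpM2r//.
  by apply: (le_trans (cell_density_le _ _)); rewrite indicE mem_set// mulr1.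
by rewrite cell_density_out ?mulr0// => /mem_set.
Qed.

Lemma cell_avg_norm_le u z : measurable_fun setT u ->
  ((`|cell_avg a h u z|)%:E <=
   ((2 / h) ^+ n)%:E * \int[L]_(x in cube a h z) (`|u x|)%:E)%E.
Proof.
move=> mu; apply: le_trans (integral_mul_cell_density_le z mu).
apply: (@le_trans _ _ `|\int[L]_x (u x * cell_density a h z x)%:E|%E).
  (* No integrability is required: [fine] sends an infinite integral to 0. *)
  by rewrite /cell_avg; case: (\int[L]_x _)%E => //= [|]; rewrite normr0 leey.
apply: le_trans (le_abse_integral _ _ _) _ => //.
by apply/measurable_EFinP/measurable_funM => //; exact: measurable_cell_density.
Qed.

Lemma integrable_mul_cell_density u z : measurable_fun setT u ->
  (\int[L]_(x in cube a h z) (`|u x|)%:E < +oo)%E ->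
  L.-integrable setT (fun x => (u x * cell_density a h z x)%:E).
Proof.
move=> mu uoo; apply/integrableP; split.
  by apply/measurable_EFinP/measurable_funM => //; exact: measurable_cell_density.
apply: (le_lt_trans (integral_mul_cell_density_le z mu)).
by rewrite lte_mul_pinfty// ?lee_fin// exprn_ge0// divr_ge0// ltW.
Qed.

Lemma cell_avg_const u z x : cube a h z x ->
  (forall y, cube a h z y -> u y = u x) -> cell_avg a h u z = u x.
Proof.
move=> zx Hu; rewrite /cell_avg.
rewrite (eq_integral (fun y => (u x)%:E * (cell_density a h z y)%:E)%E); last first.
  move=> y _; rewrite -EFinM; congr EFin.
  have [zy|zy] := pselect (cube a h z y); first by rewrite Hu.
  by rewrite cell_density_out// !mulr0.
rewrite integralZl//; first by rewrite integral_cell_density mule1.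
apply/integrableP; split; first by apply/measurable_EFinP; exact: measurable_cell_density.
under eq_integral do rewrite /= ger0_norm ?cell_density_ge0//.
by rewrite integral_cell_density ltry.
Qed.

Variable (N : nat).
Local Notation T := {ffun 'I_n -> 'I_N}.

Lemma sum_integral_cubes (c : T -> R) f : (forall z : T, 0 <= c z) ->
  (forall x, 0 <= f x) -> measurable_fun setT f ->
  (\sum_(z : T) (c z)%:E * \int[L]_(x in cube a h (corner z)) (f x)%:E =
   \int[L]_x (f x * \sum_(z : T) c z * \1_(cube a h (corner z)) x)%:E)%E.
Proof.
move=> c0 f0 mf.
under [RHS]eq_integral do rewrite mulr_sumr -sumEFin.
rewrite ge0_integral_sum//; first last.
- by move=> z x _; rewrite lee_fin !mulr_ge0.
- move=> z; apply/measurable_EFinP; apply: measurable_funM => //.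
  by apply: measurable_funM => //; apply: measurable_indic; exact: measurable_cube.
apply: eq_bigr => z _; rewrite -ge0_integralZl//; first last.
- by rewrite lee_fin.
- by move=> x _; rewrite lee_fin.
- by apply: measurable_funTS; exact/measurable_EFinP.
- exact: measurable_cube.
rewrite integral_mkcond; apply: eq_integral => x _; rewrite patchE indicE.
by case: ifP => _; rewrite -?EFinM ?mulr1 ?mulr0// mulrC.
Qed.

Lemma corner_inj (z z' : T) : corner z =1 corner z' -> z = z'.
Proof. by move=> H; apply/ffunP => i; apply/val_inj; exact: H. Qed.

Lemma sum_indic_cube (c : T -> R) (z : T) x : cube a h (corner z) x ->
  \sum_(z' : T) c z' * \1_(cube a h (corner z')) x = c z.
Proof.
move=> zx; rewrite (bigD1 z)//= indicE mem_set// mulr1 big1 ?addr0// => z' z'z.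
rewrite indicE memNset ?mulr0// => z'x; move/eqP: z'z; apply.
exact/corner_inj/(cube_inj h0 z'x zx).
Qed.

Definition avg_step u x : R :=
  \sum_(z : T) cell_avg a h u (corner z) * \1_(cube a h (corner z)) x.

Lemma measurable_avg_step u : measurable_fun setT (avg_step u).
Proof.
apply: measurable_sum => z; apply: measurable_funM => //.
by apply: measurable_indic; exact: measurable_cube.
Qed.

Lemma avg_step_norm u x : `|avg_step u x| =
  \sum_(z : T) `|cell_avg a h u (corner z)| * \1_(cube a h (corner z)) x.
Proof.
have [[z zx]|H] := pselect (exists z : T, cube a h (corner z) x).
  by rewrite /avg_step !(sum_indic_cube _ zx).
by rewrite /avg_step !big1 ?normr0// => z _; rewrite indicE memNset ?mulr0// => zx; apply: H; exists z.
Qed.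

(** Needed for two measures: Lebesgue measure, for convergence in L^1, and [mu], for the final
    estimate. *)
Lemma integral_avg_step (nu : {measure set 'rV[R]_n -> \bar R}) u D : measurable D ->
  (\int[nu]_(x in D) (`|avg_step u x|)%:E =
   \sum_(z : T) (`|cell_avg a h u (corner z)|)%:E * nu (cube a h (corner z) `&` D))%E.
Proof.
move=> mD; under eq_integral do rewrite avg_step_norm -sumEFin.
have mI (z : T) : measurable_fun D (fun x => (\1_(cube a h (corner z)) x : R)).
  by apply: measurable_indic; exact: measurable_cube.
rewrite ge0_integral_sum//; first last.
- by move=> z; apply/measurable_EFinP; exact: measurable_funM.
apply: eq_bigr => z _.
under eq_integral do rewrite EFinM.
rewrite ge0_integralZl//; last exact/measurable_EFinP.
by rewrite integral_indic//; exact: measurable_cube.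
Qed.

End cell_averages.

Section avg_step_convergence.
Context {R : realType} {n : nat}.
Variables (a : R) (p : nat).
Local Notation L := (lebesgue_rV n).
Implicit Types (x : 'rV[R]_n).
Local Notation h k := (@GRing.exp R 2^-1 k).
Let h0 k : 0 < h k. Proof. by rewrite exprn_gt0. Qed.

Definition box : set 'rV[R]_n := [set x | forall i, a <= x ord0 i < a + 2 ^+ p].

Let hN k : h k * (2 ^ (p + k))%:R = 2 ^+ p.
Proof. by rewrite natrX exprD mulrCA -exprMn mulVf// expr1n mulr1. Qed.

Lemma box_cubeP k x : box x <->
  exists z : {ffun 'I_n -> 'I_(2 ^ (p + k))}, cube a (h k) (corner z) x.
Proof.
split=> [Bx|[z zx] i]; last first.
  have /andP[H1 H2] := zx i; apply/andP; split.
    by apply: le_trans H1; rewrite lerDl mulr_ge0// ltW.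
  apply: (lt_le_trans H2); rewrite lerD2l -(hN k) ler_pM2l// ler_nat.
  exact: ltn_ord.
have q0 i : 0 <= (x ord0 i - a) / h k.
  by have /andP[? _] := Bx i; rewrite divr_ge0 ?subr_ge0// ltW.
have zP i : (Num.truncn ((x ord0 i - a) / h k) < 2 ^ (p + k))%N.
  rewrite -(ltr_nat R); have /andP[H _] := truncn_itv (q0 i); apply: (le_lt_trans H).
  rewrite ltr_pdivrMr// mulrC hN; have /andP[_] := Bx i; lra.
exists [ffun i => Ordinal (zP i)] => i; rewrite /corner ffunE /=.
have /andP[H1 H2] := truncn_itv (q0 i).
rewrite -lerBrDl -ltrBlDl; apply/andP; split.
  by rewrite mulrC -ler_pdivlMr.
by rewrite mulrC -ltr_pdivrMr.
Qed.

Lemma measurable_box : measurable box.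
Proof.
rewrite (_ : box = [set x | forall i, `[a, a + 2 ^+ p[%classic (x ord0 i)]).
  exact: (@measurable_forall_coord _ _ (fun=> `[a, a + 2 ^+ p[%classic)).
by apply/seteqP; split => x /= H i; have := H i; rewrite in_itv.
Qed.

Lemma lebesgue_box : L box = (2 ^+ p ^+ n)%:E.
Proof.
rewrite (_ : box = cube a (2 ^+ p) (fun=> 0%N)); first by rewrite lebesgue_cube ?exprn_gt0.
by apply/seteqP; split => x /= H i; have := H i; rewrite mulr0 mulr1 addr0.
Qed.

Local Notation T k := {ffun 'I_n -> 'I_(2 ^ (p + k))}.
Local Notation avg k := (@avg_step R n a (h k) (2 ^ (p + k))).

Lemma cube_subset_box k (z : T k) : cube a (h k) (corner z) `<=` box.
Proof. by move=> x zx; apply/(box_cubeP k); exists z. Qed.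

Lemma integral_cube_le_box k (z : T k) (f : 'rV[R]_n -> R) : measurable_fun setT f ->
  (\int[L]_(x in cube a (h k) (corner z)) (`|f x|)%:E <= \int[L]_(x in box) (`|f x|)%:E)%E.
Proof.
move=> mf; apply: ge0_subset_integral => //.
- exact: measurable_cube.
- exact: measurable_box.
- by apply/measurable_EFinP; apply: measurable_funTS; exact: measurableT_comp.
- exact: cube_subset_box.
Qed.

(** The height [(2 / h) ^+ n] of a bump is compensated by the volume [h ^+ n] of its cube, so
    averaging is bounded on L^1(box) uniformly in [k]. *)
Lemma integral_avg_step_le k (f : 'rV[R]_n -> R) : measurable_fun setT f ->
  (\int[L]_(x in box) (`|avg k f x|)%:E <= (2 ^+ n)%:E * \int[L]_(x in box) (`|f x|)%:E)%E.
Proof.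
move=> mf; rewrite integral_avg_step//; last exact: measurable_box.
apply: (@le_trans _ _ (\sum_(z : T k) (2 ^+ n)%:E * \int[L]_(x in cube a (h k) (corner z)) (`|f x|)%:E)%E).
  apply: lee_sum => z _; rewrite setIidl; last exact: cube_subset_box.
  rewrite [X in (_ * X <= _)%E](lebesgue_cube a (corner z) (h0 k)).
  have := cell_avg_norm_le a (h0 k) (corner z) mf.
  rewrite -(@lee_pmul2r _ ((h k) ^+ n)%:E) ?lte_fin ?exprn_gt0//.
  move/le_trans; apply; rewrite muleAC -EFinM expr_div_n divfK// gt_eqF// exprn_gt0.
rewrite (@sum_integral_cubes R n a (h k) _ (fun=> 2 ^+ n) (fun x => `|f x|))//; last first.
  exact: measurableT_comp.
rewrite -ge0_integralZl//; first last.
- by apply/measurable_EFinP; apply: measurable_funTS; exact: measurableT_comp.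
- exact: measurable_box.
rewrite [leRHS]integral_mkcond le_eqVlt; apply/orP; left; apply/eqP.
apply: eq_integral => x _; rewrite patchE; case: ifPn => [/set_mem|/negP xB].
  by move/(box_cubeP k) => [z zx]; rewrite (sum_indic_cube (h0 k) (fun=> 2 ^+ n) zx) EFinM muleC.
rewrite big1 ?mulr0// => z _; rewrite indicE memNset ?mulr0// => zx.
by apply: xB; apply/mem_set/(box_cubeP k); exists z.
Qed.

Lemma avg_step_const k0 k (g : 'rV[R]_n -> R) x : (k0 <= k)%N ->
  constant_on_cubes a k0 g -> box x -> avg k g x = g x.
Proof.
move=> k0k sg /(box_cubeP k)[z zx]; rewrite /avg_step (sum_indic_cube (h0 k) _ zx).
apply: (cell_avg_const (h0 k) zx) => y zy.
exact: (constant_on_cubesW k0k sg zy zx).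
Qed.

Lemma avg_stepB k (f g : 'rV[R]_n -> R) x : measurable_fun setT f -> measurable_fun setT g ->
  (\int[L]_(x in box) (`|f x|)%:E < +oo)%E -> (\int[L]_(x in box) (`|g x|)%:E < +oo)%E ->
  avg k (fun x => f x - g x) x = avg k f x - avg k g x.
Proof.
move=> mf mg foo goo; rewrite /avg_step -sumrB; apply: eq_bigr => z _.
rewrite -mulrBl; congr (_ * _).
have If (f' : 'rV[R]_n -> R) : measurable_fun setT f' -> (\int[L]_(x in box) (`|f' x|)%:E < +oo)%E ->
    L.-integrable setT (fun x => (f' x * cell_density a (h k) (corner z) x)%:E).
  move=> mf' f'oo; apply: integrable_mul_cell_density => //.
  exact: le_lt_trans (integral_cube_le_box _ mf') f'oo.
rewrite /cell_avg; under eq_integral do rewrite mulrBl EFinB.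
rewrite integralB//; [|exact: If..].
by rewrite fineB//; apply: integrable_fin_num => //; exact: If.
Qed.

(** Averaging is linear, has norm at most 2^n on L^1(box), and fixes the functions constant on cubes
    of a coarser generation. If g is such a function, the error for [u] is at most (2^n + 1) times
    the distance from [u] to g. *)
Lemma avg_step_cvg (u : 'rV[R]_n -> R) (e : R) : measurable_fun setT u ->
  (\int[L]_(x in box) (`|u x|)%:E < +oo)%E -> 0 < e ->
  exists k0, forall k, (k0 <= k)%N -> (\int[L]_(x in box) (`|avg k u x - u x|)%:E <= e%:E)%E.
Proof.
move=> mu uoo e0.
have Boo : (L box < +oo)%E by rewrite lebesgue_box ltry.
have c0 : 0 < 2 ^+ n + 1 :> R by rewrite ltr_wpDr// exprn_gt0.
have [|k0 [g [mg sg ug]]] := cube_approximable_integrable a measurable_box Boo mu uoo (e := e / (2 ^+ n + 1)).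
  by rewrite divr_gt0.
have mug : measurable_fun setT (fun x => u x - g x) by exact: measurable_funB.
have goo : (\int[L]_(x in box) (`|g x|)%:E < +oo)%E.
  apply: le_lt_trans (@integral_abs_triangle _ _ _ L box measurable_box g (fun x => u x - g x) u _ _ _ _) _.
  - exact: measurable_funTS.
  - exact: measurable_funTS.
  - exact: measurable_funTS.
  - by move=> x _; rewrite -[X in `|X| <= _](subKr (u x)) [leRHS]addrC ler_normB.
  by rewrite lte_add_pinfty// (le_lt_trans ug)// ltry.
exists k0 => k kk0.
apply: le_trans (@integral_abs_triangle _ _ _ L box measurable_box (fun x => avg k u x - u x)
  (avg k (fun x => u x - g x)) (fun x => u x - g x) _ _ _ _) _.
- apply: measurable_funTS; apply: measurable_funB => //; exact: measurable_avg_step.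
- by apply: measurable_funTS; exact: measurable_avg_step.
- exact: measurable_funTS.
- move=> x Bx; rewrite avg_stepB// (avg_step_const kk0 sg Bx).
  by rewrite [`|u x - g x|]distrC (_ : avg k u x - u x = (avg k u x - g x) + (g x - u x)) ?ler_normD//; ring.
apply: (@le_trans _ _ ((2 ^+ n)%:E * (e / (2 ^+ n + 1))%:E + (e / (2 ^+ n + 1))%:E)%E).
  apply: leeD => //; apply: (le_trans (integral_avg_step_le k mug)).
  by apply: lee_wpmul2l => //; rewrite lee_fin exprn_ge0.
rewrite -EFinM -EFinD lee_fin -[X in _ + X]mul1r -mulrDl mulrC divfK// gt_eqF//.
Qed.

End avg_step_convergence.

Section L1_ae.
Context d (T : measurableType d) (R : realType).
Variables (D : set T).
Hypothesis mD : measurable D.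
Variables (f : (T -> R)^nat) (u : T -> R).
Hypothesis mf : forall i, measurable_fun D (f i).
Hypothesis mu_ : measurable_fun D u.

(** The series of the |f_i - u| has finite integral, so it converges almost everywhere and its terms
    tend to 0. *)
Lemma ae_cvg_of_L1_summable (mu : {measure set T -> \bar R}) :
  (forall i, \int[mu]_(x in D) (`|f i x - u x|)%:E <= (1 / (2 ^ i.+1)%:R)%:E)%E ->
  {ae mu, forall x, D x -> f i x @[i --> \oo] --> u x}.
Proof.
move=> H; pose F i x := (`|f i x - u x|)%:E.
have mF i : measurable_fun D (F i).
  by apply/measurable_EFinP; apply: measurableT_comp => //; exact: measurable_funB.
have F0 i x : (0 <= F i x)%E by rewrite lee_fin.
have S0 x : (0 <= \sum_(i <oo) F i x)%E by apply: nneseries_ge0.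
have Soo : (\int[mu]_(x in D) (\sum_(i <oo) F i x) < +oo)%E.
  rewrite integral_nneseries//.
  apply: (@le_lt_trans _ _ (\sum_(i <oo) (1 / (2 ^ i.+1)%:R)%:E)%E).
    by apply: lee_nneseries => [i _ _|i _]; [exact: integral_ge0|exact: H].
  by apply: (le_lt_trans (epsilon_trick0 _ _)) => //; rewrite ltry.
have iS : mu.-integrable D (fun x => \sum_(i <oo) F i x)%E.
  apply/integrableP; split; first exact: ge0_emeasurable_sum.
  by under eq_integral do rewrite gee0_abs//.
have [N [mN N0 HN]] := integrable_ae mD iS.
exists N; split=> //; apply: subset_trans HN => x; apply: contra_not => Hx Dx.
have := Hx Dx; rewrite ge0_fin_numE// => Sx.
have cS : cvgn (series (fun i => `|f i x - u x|)).
  apply: nondecreasing_is_cvgn.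
    by apply: nondecreasing_series => i _ _.
  exists (fine (\sum_(i <oo) F i x)%E) => _ [m _ <-].
  rewrite -lee_fin fineK ?ge0_fin_numE// /series/= -sumEFin.
  exact: nneseries_lim_ge.
apply/cvgrPdist_le => e e0.
have /cvgrPdist_le/(_ _ e0) := cvg_series_cvg_0 cS.
by apply: filterS => i; rewrite sub0r normrN normr_id distrC.
Qed.

Lemma fatou_ae (nu : {measure set T -> \bar R}) (C : \bar R) :
  {ae nu, forall x, D x -> f i x @[i --> \oo] --> u x} ->
  (forall i, \int[nu]_(x in D) (`|f i x|)%:E <= C)%E ->
  (\int[nu]_(x in D) (`|u x|)%:E <= C)%E.
Proof.
move=> [N [mN N0 HN]] HC.
have mau (g : T -> R) (E : set T) : measurable_fun D g -> E `<=` D -> measurable_fun E (fun x => (`|g x|)%:E : \bar R).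
  move=> mg ED; apply/measurable_EFinP; apply: measurableT_comp => //.
  exact: measurable_funS mg.
rewrite (ge0_negligible_integral _ _ _ _ N0)//; last exact: mau.
have mDN : measurable (D `\` N) by exact: measurableD.
have DN : D `\` N `<=` D by move=> x [].
rewrite (eq_integral (fun x => limn_einf (fun i => (`|f i x|)%:E))); last first.
  move=> x /set_mem[Dx Nx]; symmetry; apply: (cvg_limn_einf_sup _).1.
  apply: cvg_EFin; first exact: nearW.
  apply: cvg_norm; apply: contrapT => H; apply: Nx; apply: HN => /= H'.
  exact/H/H'.
apply: (le_trans (fatou _ _ _ _)) => //; first by move=> i; exact: mau.
rewrite limn_einf_lim; apply: lime_le; first exact: is_cvg_einfs.
apply: nearW => i; apply: (@le_trans _ _ (\int[nu]_(x in D `\` N) (`|f i x|)%:E)%E).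
  by apply: ereal_inf_lbound => /=; exists i => /=.
apply: le_trans (HC i); apply: ge0_subset_integral => //.
exact: mau.
Qed.
End L1_ae.

(** * Edge weights and the variation *)

(* [M1 mu] is not known to be measurable, hence the absence of measurability
   hypotheses. *)
Lemma le_integral_ge0 d (T : measurableType d) (R : realType)
    (mu : {measure set T -> \bar R}) (f g : T -> \bar R) :
  (forall x, 0 <= f x)%E -> (forall x, f x <= g x)%E ->
  (\int[mu]_x f x <= \int[mu]_x g x)%E.
Proof.
move=> f0 fg; have g0 x : (0 <= g x)%E by apply: le_trans (fg x).
rewrite !ge0_integralTE//; apply: le_ereal_sup => _ [s sf <-].
by exists s => // x; exact: le_trans (sf x) (fg x).
Qed.

Section cube_measures.
Context {R : realType} {n N : nat}.
Variables (a h : R).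
Hypothesis h0 : 0 < h.
Local Notation T := {ffun 'I_n -> 'I_N}.

Lemma sum_measure_cubes_le (mu : {measure set 'rV[R]_n -> \bar R}) (P : pred T) S :
  measurable S -> (forall z : T, P z -> cube a h (corner z) `<=` S) ->
  (\sum_(z : T | P z) mu (cube a h (corner z)) <= mu S)%E.
Proof.
move=> mS PS.
have mc (z : T) : measurable (cube a h (corner z)) by exact: measurable_cube.
suff H (r : seq T) : uniq r -> (\sum_(z <- r | P z) mu (cube a h (corner z)) =
    mu (\big[setU/set0]_(z <- r | P z) cube a h (corner z)))%E.
  rewrite H ?index_enum_uniq//; apply: le_measure; rewrite ?inE//.
    exact: bigsetU_measurable.
  by rewrite -bigcup_seq_cond => x [z /= /andP[_ Pz] zx]; exact: PS zx.
elim: r => [|z r IH] /=; first by rewrite !big_nil measure0.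
move=> /andP[zr ur]; rewrite !big_cons; case: ifP => _; last exact: IH.
rewrite IH// measureU//; first exact: bigsetU_measurable.
apply/eqP/negPn/negP => /set0P[x [zx]].
rewrite -bigcup_seq_cond => -[z' /= /andP[z'r _] z'x].
by move: zr; rewrite (corner_inj (cube_inj h0 zx z'x)) z'r.
Qed.

End cube_measures.

Section edge_weights.
Context {R : realType} {n J : nat}.
Variables (a h : R).
Hypothesis h0 : 0 < h.
Hypothesis n0 : (0 < n)%N.
Variable mu : {measure set 'rV[R]_n -> \bar R}.
Local Notation T := {ffun 'I_n -> 'I_(2 ^ J)}.
Hypothesis mu_cube : forall z : T, (mu (cube a h (corner z)) < +oo)%E.
Implicit Types (z : T) (i : 'I_n) (x : 'rV[R]_n).

Definition cell_mass z : R := fine (mu (cube a h (corner z))).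

(** The scale [j = J] always qualifies, the grid being one cell then. On the last layer [up i z = z]
    and every scale qualifies, which is harmless since such an edge carries no difference. *)
Definition edge_weight i z : R :=
  \big[Num.max/0]_(j < J.+1 | cell j (up i z) == cell j z)
    (((2 ^ j)%:R ^+ n.-1)^-1 * \sum_(x | cell j x == cell j z) cell_mass x).

Lemma cell_mass_ge0 z : 0 <= cell_mass z.
Proof. exact: fine_ge0. Qed.

Lemma cell_massE z : ((cell_mass z)%:E = mu (cube a h (corner z)))%E.
Proof. by rewrite fineK// ge0_fin_numE. Qed.

Lemma edge_weight_ge0 i z : 0 <= edge_weight i z.
Proof. exact: bigmax_ge_id. Qed.

Lemma sum_cell_mass_le_edge_weight j i z : (j <= J)%N -> cell j (up i z) = cell j z ->
  \sum_(x | cell j x == cell j z) cell_mass x <= (2 ^ j)%:R ^+ n.-1 * edge_weight i z.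
Proof.
move=> jJ ej; have p0 : 0 < (2 ^ j)%:R ^+ n.-1 :> R by rewrite exprn_gt0// ltr0n expn_gt0.
rewrite -ler_pdivrMl//.
pose F (j : 'I_J.+1) := ((2 ^ j)%:R ^+ n.-1)^-1 * \sum_(x | cell j x == cell j z) cell_mass x.
have := @le_bigmax_cond _ _ _ 0 (Ordinal (jJ : j < J.+1)%N) (fun j => cell j (up i z) == cell j z) F.
by rewrite /= ej eqxx; apply.
Qed.

Lemma corner_up i z : up i z = z \/ corner (up i z) =1 nat_up i (corner z).
Proof.
have [zN|zN] := boolP ((z i).+1 < 2 ^ J)%N.
  right=> k; rewrite /corner /nat_up ffunE; case: eqP => // ->.
  by rewrite val_next.
left; apply/ffunP => k; rewrite ffunE; case: eqP => // ->.
by apply/val_inj; rewrite val_insubd (negbTE zN).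
Qed.

(** A dyadic cell containing both ends of the edge has [x] in its closure, so it lies in a ball
    about [x] of radius comparable to its side. The power of [2 ^ j] produced by [measure_le_M1] is
    the one divided out in the weight. *)
Lemma edge_weight_le_M1 i z x : up i z <> z ->
  (forall j, a + h * (corner z j)%:R <= x ord0 j <= a + h * (nat_up i (corner z) j).+1%:R) ->
  ((edge_weight i z)%:E <= (2 ^+ n * n.+1%:R ^+ n.-1 * h ^+ n.-1)%:E * M1 mu x)%E.
Proof.
move=> /eqP uz Hx.
have uzE : corner (up i z) =1 nat_up i (corner z).
  by case: (corner_up i z) => // E; rewrite E eqxx in uz.
set c := 2 ^+ n * _ * _.
have c0 : 0 < c by rewrite !mulr_gt0 ?exprn_gt0.
have M0 : (0 <= M1 mu x)%E.
  have := @measure_le_M1 R n mu x 1 set0 n0 ltr01 measurable0 (@sub0set _ _).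
  by rewrite measure0 pmule_rge0// lte_fin mulr_gt0// exprn_gt0.
case M1x : (M1 mu x) M0 => [r| |] //; last by move=> _; rewrite gt0_muley ?lte_fin// leey.
rewrite lee_fin => r0; rewrite -EFinM lee_fin; apply: bigmax_le.
  by rewrite mulr_ge0// ltW.
move=> j /eqP uj.
have p0 : 0 < (2 ^ j)%:R :> R by rewrite ltr0n expn_gt0.
have q0 : 0 < (2 ^ j)%:R ^+ n.-1 :> R by rewrite exprn_gt0.
rewrite ler_pdivrMl//.
(* Each coordinate of [y - x] is at most one cell side, so [n] sides bound the norm; the extra one
   makes the inequality strict, as the open ball demands. *)
pose rho := n.+1%:R * (h * (2 ^ j)%:R).
have rho0 : 0 < rho by rewrite !mulr_gt0.
have cells (z' : T) : cell j z' == cell j z -> cube a h (corner z') `<=` eball x rho.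
  move=> /eqP z'z y z'y; rewrite /eball /=.
  apply: (le_lt_trans (enorm_le _)).
  apply: (@le_lt_trans _ _ (\sum_(k < n) h * (2 ^ j)%:R)); last first.
    rewrite sumr_const card_ord -[X in X < _]mulr_natl /rho ltr_pM2r ?mulr_gt0//.
    by rewrite ltr_nat.
  apply: ler_sum => k _; rewrite !mxE.
  have j0 : (0 < 2 ^ j)%N by rewrite expn_gt0.
  pose q := (z k %/ 2 ^ j)%N.
  have z'q : (z' k %/ 2 ^ j = q)%N.
    by have /ffunP/(_ k)/(congr1 val) := z'z; rewrite !ffunE.
  have uq : (corner (up i z) k %/ 2 ^ j = q)%N.
    by have /eqP/cellP/(_ k) E := uj; rewrite /corner E ffunE.
  have bounds (s : nat) : (s %/ 2 ^ j = q -> q * 2 ^ j <= s /\ s.+1 <= q * 2 ^ j + 2 ^ j)%N.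
    move=> <-; split; first exact: leq_trunc_div.
    by rewrite -mulSnr ltn_ceil.
  have [Z1 Z2] := bounds _ (erefl : (z k %/ 2 ^ j = q)%N).
  have [Z1' Z2'] := bounds _ z'q.
  have [U1 U2] := bounds _ uq.
  have /andP[X1 X2] := Hx k; have /andP[Y1 Y2] := z'y k.
  pose l := a + h * (q * 2 ^ j)%:R.
  have mono (s t : nat) : (s <= t)%N -> a + h * s%:R <= a + h * t%:R.
    by move=> st; rewrite lerD2l ler_pM2l// ler_nat.
  have lE : l + h * (2 ^ j)%:R = a + h * (q * 2 ^ j + 2 ^ j)%:R by rewrite /l natrD; ring.
  have lx : l <= x ord0 k by apply: le_trans X1; exact: mono.
  have ly : l <= y ord0 k by apply: le_trans Y1; exact: mono.
  have xl : x ord0 k <= l + h * (2 ^ j)%:R.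
    by rewrite lE; apply: (le_trans X2); apply: mono; rewrite -uzE.
  have yl : y ord0 k <= l + h * (2 ^ j)%:R.
    by rewrite lE; apply: (le_trans (ltW Y2)); exact: mono.
  by rewrite ler_norml; apply/andP; split; lra.
have := @sum_measure_cubes_le R n _ a h h0 mu (fun z' => cell j z' == cell j z) (eball x rho)
  (measurable_eball x rho) cells.
under eq_bigr do rewrite -cell_massE.
rewrite sumEFin => /le_trans/(_ (measure_le_M1 mu n0 rho0 (measurable_eball x rho) (@subset_refl _ _))).
rewrite M1x -EFinM lee_fin => /le_trans; apply.
rewrite le_eqVlt; apply/orP; left; apply/eqP.
by rewrite /rho /c !exprMn; ring.
Qed.

End edge_weights.

Section edge_sum.
Context {R : realType} {n J : nat}.
Variables (a h : R).
Hypothesis h0 : 0 < h.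
Hypothesis n0 : (0 < n)%N.
Variable mu : {measure set 'rV[R]_n -> \bar R}.
Local Notation T := {ffun 'I_n -> 'I_(2 ^ J)}.
Hypothesis mu_cube : forall z : T, (mu (cube a h (corner z)) < +oo)%E.
Implicit Types (z : T) (i : 'I_n) (x : 'rV[R]_n).
Local Notation W := (edge_weight a h mu).
Local Notation K0 := (2 ^+ n * n.+1%:R ^+ n.-1 : R).

Lemma M1_ge0 x : (0 <= M1 mu x)%E.
Proof.
have := @measure_le_M1 R n mu x 1 set0 n0 ltr01 measurable0 (@sub0set _ _).
by rewrite measure0 pmule_rge0// lte_fin mulr_gt0// exprn_gt0.
Qed.

Lemma edge_sum_le_variation (u : 'rV[R]_n -> R) :
  (forall z : 'I_n -> nat, (lebesgue_rV n).-integrable setT (fun x => (u x * cell_density a h z x)%:E)) ->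
  ((\sum_i \sum_(z : T) W i z *
     `|cell_avg a h u (corner z) - cell_avg a h u (corner (up i z))|)%:E <=
   (n%:R * 2 ^+ n.-1 * K0)%:E * variation_weight (M1 mu) u)%E.
Proof.
move=> iu; set K1 := n%:R * _ * _.
have K00 : 0 < K0 by rewrite mulr_gt0 ?exprn_gt0.
have K10 : 0 < K1 by rewrite /K1 !mulr_gt0 ?ltr0n ?exprn_gt0.
pose d i z := cell_avg a h u (corner z) - cell_avg a h u (corner (up i z)).
(* The signs turn the tested sum into a sum of absolute values; [K1] is what normalizes the field to
   norm at most [M1 mu]. *)
pose s i z := W i z * Num.sg (d i z) / K1.
have sup i z : up i z = z -> s i z = 0 by rewrite /s /d => ->; rewrite subrr sgr0 mulr0 mul0r.
have sW i z : `|s i z| <= W i z / K1.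
  rewrite /s normrM normfV (gtr0_norm K10) ler_pM2r ?invr_gt0// normrM.
  rewrite ger0_norm ?edge_weight_ge0// ler_piMr ?edge_weight_ge0// normr_sg.
  by case: eqP.
have field_le x : ((enorm (edge_field a h s x))%:E <= M1 mu x)%E.
  case M1x : (M1 mu x) (M1_ge0 x) => [r| |] //; last by move=> _; exact: leey.
  rewrite !lee_fin => r0.
  apply: (@le_trans _ _ (n%:R * ((K0 * h ^+ n.-1 * r / K1) * (2 / h) ^+ n.-1))); last first.
    rewrite expr_div_n /K1 le_eqVlt; apply/orP; left; apply/eqP; field.
    by rewrite !expf_neq0 ?gt_eqF ?ltr0n//.
  apply: enorm_edge_field_le => //.
    by rewrite divr_ge0 ?(ltW K10)// !mulr_ge0// exprn_ge0// ltW.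
  move=> i z zx; have [uz|uz] := eqVneq (up i z) z.
    by rewrite sup// normr0 divr_ge0 ?(ltW K10)// !mulr_ge0// exprn_ge0// ltW.
  apply: (le_trans (sW i z)); rewrite ler_pM2r ?invr_gt0// -lee_fin EFinM -M1x.
  by apply: edge_weight_le_M1 => //; [exact/eqP|exact: edge_potential_neq0].
have := variation_ge_edge_sum h0 iu field_le.
rewrite -(@lee_pmul2l _ K1%:E) ?lte_fin// -EFinM; congr ((_%:E <= _)%E).
rewrite mulr_sumr; apply: eq_bigr => i _; rewrite mulr_sumr; apply: eq_bigr => z _.
have [uz|uz] := corner_up i z.
  by rewrite (sup _ _ uz) uz subrr normr0 mul0r !mulr0.
rewrite -(funext uz) -/(d i z) /s normrEsg; field.
by rewrite gt_eqF.
Qed.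

End edge_sum.

(** * Cutoff in one coordinate *)

Section cutoff.
Context {R : realType} {n J : nat}.
Local Notation T := {ffun 'I_n -> 'I_(2 ^ J)}.
Variable i0 : 'I_n.
Implicit Types (z : T) (i : 'I_n).
Local Notation N := ((2 ^ J)%:R : R).
Let N0 : 0 < N. Proof. by rewrite ltr0n expn_gt0. Qed.

(** The value is 1 on the first quarter of the grid in direction [i0], which will hold the box of
    interest, and 0 from the middle on, which makes the support sparse. *)
Definition cutoff z : R := Num.min 1 (Num.max 0 (2 - 4 * (z i0)%:R / N)).

Lemma cutoff_itv01 z : 0 <= cutoff z <= 1.
Proof. by rewrite /cutoff le_min ler01 le_max lexx ge_min lexx. Qed.

Lemma cutoff_eq1 z : 4 * (z i0)%:R <= N -> cutoff z = 1.
Proof.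
move=> H; have : 4 * (z i0)%:R / N <= 1 by rewrite ler_pdivrMr// mul1r.
by rewrite /cutoff => {}H; rewrite max_r ?min_l//; lra.
Qed.

Lemma cutoff_eq0 z : z \notin [set z : T | (2 * z i0 < 2 ^ J)%N]%SET -> cutoff z = 0.
Proof.
rewrite inE -leqNgt -(ler_nat R) natrM => H.
have : 2 <= 4 * (z i0)%:R / N by rewrite ler_pdivlMr//; lra.
by rewrite /cutoff => {}H; rewrite max_l ?min_r//; lra.
Qed.

Lemma cutoff_lipschitz i z : `|cutoff z - cutoff (up i z)| <= 4 / N.
Proof.
have clamp (x y e : R) : `|x - y| <= e ->
    `|Num.min 1 (Num.max 0 x) - Num.min 1 (Num.max 0 y)| <= e.
  move=> /ler_normlP[H1 H2]; apply/ler_normlP.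
  by rewrite /Num.min /Num.max; split; do ![case: ifP => /negP; rewrite ?negbK -?leNgt] => *; lra.
apply: clamp.
rewrite (_ : _ - _ = 4 / N * ((up i z i0)%:R - (z i0)%:R)); last by ring.
have p : 0 <= 4 / N by rewrite divr_ge0// ltW.
rewrite normrM (ger0_norm p) ler_piMr//.
have [->|/(_ i0)] := corner_up i z; first by rewrite subrr normr0.
rewrite /corner /nat_up => ->; case: eqP => _; last by rewrite subrr normr0.
by rewrite -natr1 addrAC subrr add0r normr1.
Qed.

(** Reflection in direction [i0] maps the support onto a disjoint set; [0 < J] makes the number of
    layers even. *)
Lemma card_cutoff_support : (0 < J)%N ->
  (2 * #|[set z : T | (2 * z i0 < 2 ^ J)%N]%SET| <= #|{: T}|)%N.
Proof.
move=> J0; set S := [set z : T | _]%SET.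
pose f z : T := [ffun k => if k == i0 then rev_ord (z k) else z k].
have fK : involutive f.
  by move=> z; apply/ffunP => k; rewrite !ffunE; case: eqP => // _; rewrite rev_ordK.
have dis : (S :&: f @: S = finset.set0)%SET.
  apply/finset.setP => y; rewrite finset.in_setI finset.in_set0; apply/negP.
  case/andP => yS /imsetP[z zS yE]; move: yS zS; rewrite yE !inE ffunE eqxx /=.
  have := ltn_ord (z i0); have : (2 ^ J = 2 * 2 ^ J.-1)%N by rewrite -expnS prednK.
  by set q := nat_of_ord _; lia.
rewrite mul2n -addnn -{2}(card_imset _ (inv_inj fK)) -cardsUI.
by rewrite dis cards0 addn0; exact: max_card.
Qed.

End cutoff.

Section cutoff_inequality.
Context {R : realType} {n J : nat}.
Variables (a h : R).
Hypothesis h0 : 0 < h.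
Hypothesis n0 : (0 < n)%N.
Hypothesis J0 : (0 < J)%N.
Variable mu : {measure set 'rV[R]_n -> \bar R}.
Local Notation T := {ffun 'I_n -> 'I_(2 ^ J)}.
Hypothesis mu_cube : forall z : T, (mu (cube a h (corner z)) < +oo)%E.
Implicit Types (z : T) (i : 'I_n) (x : 'rV[R]_n).
Local Notation W := (edge_weight a h mu).
Local Notation K0 := (2 ^+ n * n.+1%:R ^+ n.-1 : R).
Local Notation N := ((2 ^ J)%:R : R).
Local Notation L := (lebesgue_rV n).
Variable u : 'rV[R]_n -> R.
Hypothesis mu_ : measurable_fun setT u.
Hypothesis iu : forall z : 'I_n -> nat,
  L.-integrable setT (fun x => (u x * cell_density a h z x)%:E).
Local Notation U z := (cell_avg a h u (corner z)).
Local Notation E := (\int[L]_x (`|u x|%:E * M1 mu x))%E.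

(** The self-edges of the last layer are discarded because [edge_weight_le_M1] excludes them. *)
Let W' i z : R := if up i z == z then 0 else W i z.

Let c := K0 * h ^+ n.-1.
Let c0 : 0 < c. Proof. by rewrite !mulr_gt0 ?exprn_gt0. Qed.

Let W'0 i z : 0 <= W' i z.
Proof. by rewrite /W'; case: ifP => // _; exact: edge_weight_ge0. Qed.

(** On the cube of [z] the weight is at most [c] times [M1 mu], and |U z| is at most [(2 / h) ^+ n]
    times the integral of |u| over this cube; the cubes are disjoint. The resulting factor is of
    order 1/h. *)
Let sum_edge_weight_avg i :
  ((\sum_(z : T) W' i z * `|U z|)%:E <= ((2 / h) ^+ n * c)%:E * E)%E.
Proof.
have p0 : 0 < (2 / h) ^+ n by rewrite exprn_gt0// divr_gt0.
apply: (@le_trans _ _ (((2 / h) ^+ n * c)%:E *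
    \sum_(z : T) (W' i z / c)%:E * \int[L]_(x in cube a h (corner z)) (`|u x|)%:E)%E).
  rewrite -sumEFin ge0_sume_distrr => [|z _]; last first.
    by apply: mule_ge0; [rewrite lee_fin divr_ge0// ltW|exact: integral_ge0].
  apply: lee_sum => z _.
  rewrite muleA -EFinM (_ : _ * (W' i z / c) = W' i z * (2 / h) ^+ n); last first.
    by field; rewrite !gt_eqF.
  rewrite !EFinM -muleA; apply: lee_wpmul2l; first by rewrite lee_fin.
  exact: cell_avg_norm_le.
apply: lee_wpmul2l; first by rewrite lee_fin mulr_ge0// ltW.
rewrite (@sum_integral_cubes R n a h _ (fun z => W' i z / c) (fun x => `|u x|))//; first last.
- exact: measurableT_comp.
- by move=> z; rewrite divr_ge0// ltW.
apply: le_integral_ge0 => x.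
  by rewrite lee_fin mulr_ge0// sumr_ge0// => z _; rewrite !mulr_ge0// invr_ge0 ltW.
rewrite EFinM; apply: lee_wpmul2l => //.
have [[z zx]|H] := pselect (exists z : T, cube a h (corner z) x); last first.
  rewrite big1 ?M1_ge0// => z _; rewrite indicE memNset ?mulr0// => zx.
  by apply: H; exists z.
rewrite (sum_indic_cube h0 (fun z => W' i z / c) zx) /W'.
case: eqP => uz; first by rewrite mul0r M1_ge0.
rewrite -(@lee_pmul2l _ c%:E) ?lte_fin// -EFinM mulrC divfK ?gt_eqF//.
apply: edge_weight_le_M1 => // j; have /andP[-> H2] := zx j; rewrite /=.
apply: (le_trans (ltW H2)); rewrite lerD2l ler_pM2l// ler_nat /nat_up.
by case: eqP.
Qed.

Lemma cutoff_sum_le (i0 : 'I_n) :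
  ((\sum_(z : T) cutoff i0 z * `|U z| * cell_mass a h mu z)%:E <=
   (2 ^+ n.+2)%:E * ((n%:R * 2 ^+ n.-1 * K0)%:E * variation_weight (M1 mu) u +
     (n%:R * (4 / N) * ((2 / h) ^+ n * c))%:E * E))%E.
Proof.
have cu01 z := cutoff_itv01 (R := R) i0 z.
have cu0 z : 0 <= cutoff i0 z * `|U z| by have /andP[? _] := cu01 z; rewrite mulr_ge0.
have cuS z : z \notin [set z : T | (2 * z i0 < 2 ^ J)%N]%SET -> cutoff i0 z * `|U z| = 0.
  by move=> zS; rewrite cutoff_eq0// mul0r.
have sob := discrete_weighted_sobolev (cell_mass_ge0 a h mu) (edge_weight_ge0 a h mu) n0
  (@sum_cell_mass_le_edge_weight R n J a h mu)
  (card_cutoff_support i0 J0) cu0 cuS.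
pose V z := cutoff i0 z * `|U z|.
apply: (@le_trans _ _ (2 ^+ n.+2 * \sum_i \sum_z W i z * `|V z - V (up i z)|)%:E).
  by rewrite lee_fin; exact: sob.
rewrite EFinM; apply: lee_wpmul2l; first by rewrite lee_fin exprn_ge0.
apply: (@le_trans _ _ ((\sum_i \sum_z W i z * `|U z - U (up i z)|)%:E +
   (4 / N * \sum_i \sum_z W' i z * `|U z|)%:E)%E).
  rewrite -EFinD lee_fin mulr_sumr -big_split/=; apply: ler_sum => i _.
  rewrite mulr_sumr.
  apply: (@le_trans _ _ (\sum_z (W i z * `|U z - U (up i z)| + 4 / N * (W' i z * `|U z|)))); last first.
    by rewrite big_split; exact: lexx.
  apply: ler_sum => z _.
  have W0 := edge_weight_ge0 a h mu i z.
  rewrite /W'; case: eqP => uz; first by rewrite uz !subrr normr0 !mulr0 mul0r mulr0 addr0.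
  rewrite [4 / N * _]mulrCA -mulrDr; apply: ler_wpM2l => //.
  (* Discrete product rule: the first term is controlled by the variation, the second by the slope
     of the cutoff. *)
  rewrite (_ : V z - V _ = cutoff i0 (up i z) * (`|U z| - `|U (up i z)|) +
     (cutoff i0 z - cutoff i0 (up i z)) * `|U z|); last by rewrite /V; ring.
  apply: (le_trans (ler_normD _ _)); rewrite !normrM normr_id; apply: lerD.
    have /andP[p0 p1] := cu01 (up i z).
    rewrite (ger0_norm p0); apply: (le_trans (ler_piMl _ _)) => //.
    exact: ler_dist_dist.
  by apply: ler_wpM2r => //; exact: cutoff_lipschitz.
apply: leeD; first exact: edge_sum_le_variation.
rewrite (_ : n%:R * (4 / N) * _ = 4 / N * (n%:R * ((2 / h) ^+ n * c))); last by ring.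
have q0 : 0 <= 4 / N by rewrite divr_ge0.
rewrite EFinM [X in (_ <= X * _)%E]EFinM -muleA; apply: lee_wpmul2l; first by rewrite lee_fin.
rewrite -sumEFin; apply: (@le_trans _ _ (\sum_(i < n) ((2 / h) ^+ n * c)%:E * E)%E).
  by apply: lee_sum => i _; exact: sum_edge_weight_avg.
rewrite -ge0_sume_distrl => [|i _]; last by rewrite lee_fin mulr_ge0 ?(ltW c0)// exprn_ge0// divr_ge0// ltW.
by rewrite sumEFin sumr_const card_ord -[X in (X%:E * _)%E]mulr_natl EFinM -muleA.
Qed.

End cutoff_inequality.

(** * Exhaustion by boxes and local integrability *)

Section centered_boxes.
Context {R : realType} {n : nat}.
Hypothesis n0 : (0 < n)%N.
Variable mu : {measure set 'rV[R]_n -> \bar R}.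
Hypothesis mu_locfin : locally_finite mu.
Implicit Types (x : 'rV[R]_n) (u : 'rV[R]_n -> R).
Local Notation L := (lebesgue_rV n).

Lemma box_finite (a : R) p : (mu (box a p) < +oo)%E.
Proof.
pose C := [set x : 'rV[R]_n | forall i, `[a, a + 2 ^+ p]%classic (x ord0 i)].
have Cc : compact C.
  by apply: (@rV_compact _ _ (fun=> `[a, a + 2 ^+ p]%classic)) => i; exact: segment_compact.
apply: le_lt_trans (mu_locfin Cc); apply: le_measure; rewrite ?inE.
- exact: measurable_box.
- exact: (@measurable_forall_coord _ _ (fun=> `[a, a + 2 ^+ p]%classic)).
- by move=> x Bx i; have /andP[H1 H2] := Bx i; rewrite /= in_itv/= H1 ltW.
Qed.

Definition centered_box l : set 'rV[R]_n := box (- 2 ^+ l) l.+1.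

Lemma centered_boxP l x : centered_box l x <-> forall i, - 2 ^+ l <= x ord0 i < 2 ^+ l.
Proof.
have E : - 2 ^+ l + 2 ^+ l.+1 = 2 ^+ l :> R by rewrite exprS; ring.
by rewrite /centered_box /box /= E.
Qed.

Lemma centered_box_cover x : exists l0, forall l, (l0 <= l)%N -> centered_box l x.
Proof.
pose M := \sum_i `|x ord0 i|.
have M0 : 0 <= M by apply: sumr_ge0.
exists (Num.truncn M).+1 => l Ml; apply/centered_boxP => i.
have : `|x ord0 i| < 2 ^+ l.
  apply: (@le_lt_trans _ _ M).
    by rewrite /M (bigD1 i)//= lerDl sumr_ge0.
  apply: (lt_le_trans (truncnS_gt M)); rewrite -natrX ler_nat.
  by apply: (leq_trans Ml); apply: ltnW; exact: ltn_expl.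
by rewrite ltr_norml => /andP[/ltW -> ->].
Qed.

(** Some centered box has positive mass, and a ball of fixed radius about any point of the cube
    contains it; so [M1 mu] is bounded below by a positive constant on the cube, and integrability
    against the weight gives integrability. *)
Lemma local_integrability u (a h : R) (z : 'I_n -> nat) : 0 < h ->
  mu setT != 0%E -> L1_weight (M1 mu) u ->
  (\int[L]_(x in cube a h z) (`|u x|)%:E < +oo)%E.
Proof.
move=> h0 muT [mu_ uoo].
have [l mul] : exists l, mu (centered_box l) != 0%E.
  apply: contrapT => /forallNP H; move/eqP: muT; apply.
  have mb l : measurable (centered_box l) by exact: measurable_box.
  apply/eqP; rewrite eq_le measure_ge0 andbT.
  have -> : [set: 'rV[R]_n] = \bigcup_l centered_box l.
    apply/seteqP; split=> // x _; have [l0 H0] := centered_box_cover x.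
    by exists l0 => //; exact: H0.
  apply: (le_trans (measure_sigma_subadditive _ _ _ _)) => //.
    exact: bigcup_measurable.
  rewrite eseries0// => i _ _; apply/eqP; rewrite -[_ == _]negbK; apply/negP.
  exact: H.
(* This sum bounds the distance from any point of the cube to any point of the centered box; adding
   1 accounts for the open ball. *)
pose r := \sum_(k < n) (2 ^+ l + (`|a| + h * (z k).+1%:R)) + 1.
have r0 : 0 < r.
  rewrite ltr_wpDl// sumr_ge0// => k _; rewrite !addr_ge0 ?exprn_ge0// mulr_ge0// ltW//.
have [m mE] : exists m : R, mu (centered_box l) = m%:E.
  exists (fine (mu (centered_box l))); rewrite fineK// ge0_fin_numE//; exact: box_finite.
have m0 : 0 < m.
  by rewrite -lte_fin -mE lt_neqAle eq_sym mul measure_ge0.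
pose c := m / (2 ^+ n * r ^+ n.-1).
have d0 : 0 < 2 ^+ n * r ^+ n.-1 by rewrite mulr_gt0// exprn_gt0.
have c0 : 0 < c by rewrite divr_gt0.
have cM x : cube a h z x -> (c%:E <= M1 mu x)%E.
  move=> zx; rewrite -(@lee_pmul2l _ (2 ^+ n * r ^+ n.-1)%:E) ?lte_fin//.
  rewrite -EFinM mulrC divfK ?gt_eqF// -mE.
  apply: measure_le_M1 => //; first exact: measurable_box.
  move=> y /centered_boxP yl; rewrite /eball/=; apply: (le_lt_trans (enorm_le _)).
  rewrite /r ltr_pwDr//; apply: ler_sum => k _; rewrite !mxE.
  apply: (le_trans (ler_normB _ _)); apply: lerD.
    by rewrite ler_norml; have /andP[-> /ltW ->] := yl k.
  have /andP[x1 x2] := zx k.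
  have [a1 a2] : - `|a| <= a /\ a <= `|a| by rewrite lerNl ler_norm -normrN ler_norm.
  have z0 : 0 <= h * (z k)%:R by rewrite mulr_ge0// ltW.
  have z1 : h * (z k).+1%:R = h * (z k)%:R + h by rewrite -natr1; ring.
  by rewrite ler_norml; apply/andP; split; lra.
rewrite -(@lte_pmul2l _ c%:E) ?lte_fin// -ge0_integralZl//; first last.
- by rewrite lee_fin ltW.
- by apply: measurable_funTS; apply/measurable_EFinP; exact: measurableT_comp.
- exact: measurable_cube.
rewrite gt0_muley ?lte_fin//; apply: le_lt_trans uoo.
rewrite integral_mkcond; apply: le_integral_ge0 => x; rewrite patchE; case: ifPn => //.
- by move=> _; rewrite -EFinM lee_fin mulr_ge0// ltW.
- by move=> /set_mem zx; rewrite muleC; apply: lee_wpmul2l => //; exact: cM.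
- by move=> _; rewrite mule_ge0// M1_ge0.
Qed.

Lemma variation_weight_ge0 (w : 'rV[R]_n -> \bar R) u :
  (forall x, 0 <= w x)%E -> (0 <= variation_weight w u)%E.
Proof.
move=> w0; apply: ereal_sup_ubound => /=.
(* The zero field, written as an edge field so that its regularity and compact support are already
   available. *)
pose s (i : 'I_n) (z : {ffun 'I_n -> 'I_1}) : R := 0.
have F0 x : edge_field 0 1 s x = 0.
  by apply/rowP => i; rewrite !mxE big1// => z _; rewrite mul0r.
exists (edge_field 0 1 s).
  split; [exact: edge_field_C1|exact: edge_field_compact|].
  by move=> x; rewrite F0 /enorm big1 ?sqrtr0// => i _; rewrite mxE expr0n.
apply: integral0_eq => x _; rewrite divergence_edge_field// big1 ?mulr0// => i _.
by rewrite big1// => z _; rewrite mul0r.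
Qed.

End centered_boxes.

(** * Passage to the limit *)

Section weighted_inequality.
Context {R : realType} {n : nat}.
Hypothesis n0 : (0 < n)%N.
Variable mu : {measure set 'rV[R]_n -> \bar R}.
Hypothesis mu_locfin : locally_finite mu.
Local Notation L := (lebesgue_rV n).
Hypothesis mu_ac : mu `<< L.
Implicit Types (x : 'rV[R]_n) (u : 'rV[R]_n -> R).

Hypothesis muT : mu setT != 0%E.
Local Notation K0 := (2 ^+ n * n.+1%:R ^+ n.-1 : R).
Local Notation Cvar := (n%:R * 2 ^+ n.-1 * K0).
Local Notation Cerr := (n%:R * (4 * 2 ^+ n * K0) / 8).
Local Notation E u := (\int[L]_x (`|u x|%:E * M1 mu x))%E.

Lemma centered_box_subset l : centered_box l `<=` (box (- 2 ^+ l) (l + 3) : set 'rV[R]_n).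
Proof.
move=> x Bx i; have /andP[H1 H2] := Bx i; rewrite H1; apply: (lt_le_trans H2).
rewrite lerD2l; apply: ler_weXn2l; first by rewrite ler1n.
by lia.
Qed.

(** The grid has the corner -2^l in each coordinate and side 8 2^l, so the centered box of side 2
    2^l is its first quarter in every direction, where the cutoff is 1. The bound does not depend on
    [k]. *)
Lemma integral_avg_step_centered_box u l k : L1_weight (M1 mu) u ->
  (\int[mu]_(x in centered_box l)
     (`|avg_step (- 2 ^+ l) (2^-1 ^+ k) (2 ^ (l + 3 + k)) u x|)%:E <=
   (2 ^+ n.+2)%:E * (Cvar%:E * variation_weight (M1 mu) u + (Cerr / 2 ^+ l)%:E * E u))%E.
Proof.
move=> uL; have [mu_ uoo] := uL.
set a := - 2 ^+ l; set h := 2^-1 ^+ k; set J := (l + 3 + k)%N.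
have h0 : 0 < h :> R by rewrite exprn_gt0.
have hN : h * (2 ^ J)%:R = 8 * 2 ^+ l :> R.
  rewrite natrX /J /h exprD mulrCA -exprMn mulVf// expr1n mulr1 exprD; ring.
have N0 : 0 < (2 ^ J)%:R :> R by rewrite ltr0n expn_gt0.
have mu_cube (z : {ffun 'I_n -> 'I_(2 ^ J)}) : (mu (cube a h (corner z)) < +oo)%E.
  apply: le_lt_trans (box_finite mu_locfin a (l + 3)); apply: le_measure; rewrite ?inE.
  - exact: measurable_cube.
  - exact: measurable_box.
  - exact: cube_subset_box.
have iu (z : 'I_n -> nat) : L.-integrable setT (fun x => (u x * cell_density a h z x)%:E).
  by apply: integrable_mul_cell_density => //; exact: (local_integrability n0 mu_locfin a z h0 muT uL).
pose i0 : 'I_n := Ordinal n0.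
have mb : measurable (centered_box l : set 'rV[R]_n) by exact: measurable_box.
rewrite integral_avg_step//.
have J0 : (0 < J)%N by rewrite /J addn3.
(* All powers of [h] cancel except the one that combines with the number of cells into the side 8
   2^l. *)
have CE : n%:R * (4 / (2 ^ J)%:R) * ((2 / h) ^+ n * (K0 * h ^+ n.-1)) = Cerr / 2 ^+ l.
  have -> : Cerr / 2 ^+ l = n%:R * (4 * 2 ^+ n * K0) / (8 * 2 ^+ l) by field; rewrite expf_neq0.
  rewrite -hN expr_div_n -[in h ^+ n](prednK n0) exprS.
  by field; rewrite !gt_eqF// exprn_gt0.
have := cutoff_sum_le h0 n0 J0 mu_cube mu_ iu i0; rewrite CE; apply: le_trans.
rewrite -sumEFin; apply: lee_sum => z _.
have [zi|zi] := leP (4 * (z i0)%:R) ((2 ^ J)%:R : R).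
  rewrite cutoff_eq1// mul1r EFinM cell_massE//; apply: lee_wpmul2l => //.
  apply: le_measure; rewrite ?inE//; first exact: measurableI (measurable_cube _ _ _) mb.
  exact: measurable_cube.
(* Beyond the first quarter the cell lies to the right of the centered box. *)
rewrite (_ : cube _ _ _ `&` _ = set0).
  rewrite measure0 mule0 lee_fin !mulr_ge0 ?cell_mass_ge0//.
  by have /andP[] := cutoff_itv01 (R := R) i0 z.
apply/seteqP; split => // x [zx /centered_boxP/(_ i0)/andP[_ xl]].
have /andP[xz _] := zx i0.
have : h * (2 ^ J)%:R < h * (4 * (z i0)%:R) by rewrite ltr_pM2l.
move: xz; rewrite hN /a /corner => xz.
have -> : h * (4 * (z i0)%:R) = 4 * (h * (z i0)%:R) by ring.
lra.
Qed.

(** Meshes [k i] are chosen with L^1 errors 2^(-i-1), so the averages converge Lebesgue-almost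
    everywhere on the large box; absolute continuity makes the exceptional set [mu]-null, and Fatou
    applies to the uniform bound. *)
Lemma integral_centered_box u l : L1_weight (M1 mu) u ->
  (\int[mu]_(x in centered_box l) (`|u x|)%:E <=
   (2 ^+ n.+2)%:E * (Cvar%:E * variation_weight (M1 mu) u + (Cerr / 2 ^+ l)%:E * E u))%E.
Proof.
move=> uL; have [mu_ uoo] := uL.
set a : R := - 2 ^+ l.
have uboo : (\int[L]_(x in box a (l + 3)) (`|u x|)%:E < +oo)%E.
  have := @local_integrability R n n0 mu mu_locfin u a (2 ^+ (l + 3)) (fun=> 0%N) _ muT uL.
  rewrite exprn_gt0// => /(_ isT); rewrite (_ : cube _ _ _ = box a (l + 3))//.
  by apply/seteqP; split => x H i; have := H i; rewrite mulr0 mulr1 addr0.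
have /choice[k Hk] i : exists k : nat, (\int[L]_(x in box a (l + 3))
    `|avg_step a (2^-1 ^+ k) (2 ^ (l + 3 + k)) u x - u x|%:E <= (1 / (2 ^ i.+1)%:R)%:E)%E.
  have [|k H] := avg_step_cvg mu_ uboo (e := 1 / (2 ^ i.+1)%:R).
    by rewrite divr_gt0// ltr0n expn_gt0.
  by exists k; exact: H.
have mf i (D : set 'rV[R]_n) : measurable_fun D (avg_step a (2^-1 ^+ k i) (2 ^ (l + 3 + k i)) u).
  by apply: measurable_funTS; exact: measurable_avg_step.
have [N [mN N0 HN]] := ae_cvg_of_L1_summable (measurable_box a (l + 3)) (fun i => mf i _)
  (measurable_funTS mu_) Hk.
apply: (@fatou_ae _ _ R (centered_box l) _ (fun i => avg_step a (2^-1 ^+ k i) (2 ^ (l + 3 + k i)) u)).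
- exact: measurable_box.
- by move=> i; exact: mf.
- exact: measurable_funTS.
- exists N; split => //.
    by move/null_content_dominatesP : mu_ac; exact.
  apply: subset_trans HN => x; apply: contra_not => H /centered_box_subset; exact: H.
- by move=> i; exact: integral_avg_step_centered_box.
Qed.

Lemma integral_le_variation u : BV_weight (M1 mu) u ->
  (\int[mu]_x `|u x|%:E <= (2 ^+ n.+2 * Cvar)%:E * variation_weight (M1 mu) u)%E.
Proof.
move=> [uL Voo]; have [mu_ uoo] := uL.
have V0 : (0 <= variation_weight (M1 mu) u)%E by apply: variation_weight_ge0 => // x; exact: M1_ge0.
have E0 : (0 <= E u)%E.
  by apply: integral_ge0 => x _; rewrite mule_ge0// M1_ge0.
have [V VE] : exists V : R, variation_weight (M1 mu) u = V%:E.
  by exists (fine (variation_weight (M1 mu) u)); rewrite fineK// ge0_fin_numE.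
have [e eE] : exists e : R, E u = e%:E by exists (fine (E u)); rewrite fineK// ge0_fin_numE.
rewrite VE -EFinM; rewrite VE lee_fin in V0; rewrite eE lee_fin in E0.
have mb l : measurable (centered_box l : set 'rV[R]_n) by exact: measurable_box.
have Cerr0 : 0 <= Cerr by rewrite divr_ge0// !mulr_ge0// exprn_ge0.
have sub l l' : (l <= l')%N -> centered_box l `<=` (centered_box l' : set 'rV[R]_n).
  move=> ll' x /centered_boxP H; apply/centered_boxP => i; have /andP[H1 H2] := H i.
  have : 2 ^+ l <= 2 ^+ l' :> R by apply: ler_weXn2l => //; rewrite ler1n.
  by move=> ll; apply/andP; split; lra.
have B l : (\int[mu]_(x in centered_box l) `|u x|%:E <= (2 ^+ n.+2 * Cvar * V)%:E)%E.
  (* The integral over the box [l] is bounded by that over a larger box [maxn l m], whose cutoff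
     error is at most [d]. *)
  apply/lee_addgt0Pr => d d0.
  have q0 : 0 < 2 ^+ n.+2 * (Cerr * e) + 1 by rewrite ltr_wpDl// mulr_ge0// mulr_ge0.
  have [m md] := @exists_half_expn_lt R (d / (2 ^+ n.+2 * (Cerr * e) + 1)) (divr_gt0 d0 q0).
  apply: (@le_trans _ _ (\int[mu]_(x in centered_box (maxn l m)) `|u x|%:E)%E).
    apply: ge0_subset_integral => //.
      by apply: measurable_funTS; apply/measurable_EFinP; exact: measurableT_comp.
    by apply: sub; exact: leq_maxl.
  apply: (le_trans (integral_centered_box (maxn l m) uL)).
  rewrite VE eE -!EFinM -!EFinD lee_fin mulrDr mulrA lerD2l.
  have half : (2 ^+ maxn l m)^-1 <= 2^-1 ^+ m :> R.
    rewrite exprVn lef_pV2 ?posrE ?exprn_gt0//; apply: ler_weXn2l; first by rewrite ler1n.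
    exact: leq_maxr.
  rewrite [X in X <= d](_ : _ = (2 ^+ n.+2 * (Cerr * e)) * (2 ^+ maxn l m)^-1); last by rewrite -[RHS]mulrA; congr (_ * _); exact: mulrAC.
  apply: (@le_trans _ _ ((2 ^+ n.+2 * (Cerr * e) + 1) * (d / (2 ^+ n.+2 * (Cerr * e) + 1)))).
    apply: ler_pM => //.
    - by apply: mulr_ge0; [exact: exprn_ge0|exact: mulr_ge0].
    - by rewrite lerDl.
    - exact: le_trans half (ltW md).
  by rewrite mulrC divfK// gt_eqF.
apply: (@fatou_ae _ _ R setT _ (fun l x => u x * \1_(centered_box l) x)) => //.
- move=> l; apply: measurable_funM => //; exact: measurable_indic.
- apply: aeW => x _; have [l0 Hl0] := centered_box_cover x.
  apply: cvg_near_cst; exists l0 => // l /= l0l.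
  by rewrite indicE mem_set ?mulr1//; exact: Hl0.
- move=> l; apply: le_trans (B l); rewrite [leRHS]integral_mkcond.
  rewrite le_eqVlt; apply/orP; left; apply/eqP; apply: eq_integral => x _.
  rewrite patchE indicE normrM; case: ifP => _; first by rewrite normr1 mulr1.
  by rewrite normr0 mulr0.
Qed.

End weighted_inequality.

Theorem corollary2p3 (R : realType) (n : nat) (n_ge2 : (2 <= n)%N)
    (mu : {measure set 'rV[R]_n -> \bar R})
    (mu_locfin : locally_finite mu)
    (mu_ac : mu `<< lebesgue_rV n)
    (M1_fin : exists x0 : 'rV[R]_n, (M1 mu x0 < +oo)%E) :
  exists2 C : R, 0 < C &
    forall u : 'rV[R]_n -> R, BV_weight (M1 mu) u ->
      (\int[mu]_x `|u x|%:E <= C%:E * variation_weight (M1 mu) u)%E.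
Proof.
have n0 : (0 < n)%N by exact: ltnW.
exists (2 ^+ n.+2 * (n%:R * 2 ^+ n.-1 * (2 ^+ n * n.+1%:R ^+ n.-1))).
  by do ![apply: exprn_gt0 | apply: mulr_gt0]; rewrite ?ltr0n.
move=> u uBV.
(* If [mu] vanishes, the weight no longer forces [u] to be locally integrable, so this case is
   separated; both sides are then compared with 0. *)
have [muT|muT] := eqVneq (mu setT) 0%E; last exact: integral_le_variation.
rewrite (ge0_negligible_integral measurableT _ _ _ muT)//.
  rewrite setDv integral_set0; apply: mule_ge0.
    by rewrite lee_fin; do ![apply: exprn_ge0 | apply: mulr_ge0].
  by apply: variation_weight_ge0 => // x; exact: M1_ge0.
by apply/measurable_EFinP; apply: measurableT_comp => //; exact: uBV.1.1.
Qed.
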